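(* There exists a DSIC mechanism for the single-parameter fair-auction setting which, for every fixed $\varepsilon>0$, runs in polynomial time and, on every instance with truthful bids $v_1,\dots,v_n$, outputs an allocation $(A_1,\dots,A_n)\in\Pi_n([m])$ with $$\Big(\prod_{i=1}^n v_i\,w(A_i)\Big)^{1/n}\ \ge\ \frac{1}{1+\varepsilon}\ \max_{(S_1,\dots,S_n)\in\Pi_n([m])}\Big(\prod_{i=1}^n v_i\,w(S_i)\Big)^{1/n}.$$
   Context: Single-parameter fair-auction setting: $n$ agents $[n]$, $m$ indivisible goods $[m]$, a publicly known additive function $w:2^{[m]}\to\mathbb{R}_{\ge0}$, private parameters $v_i\in\mathbb{R}_{\ge0}$; agent $i$ values $S$ at $v_i w(S)$. $\Pi_n([m])$ is the set of ordered $n$-partitions of $[m]$. The right-hand maximization is the problem \textsc{FA-NSW} (maximizing Nash social welfare). A mechanism knows $[m],[n],w$, receives bids $b\in\mathbb{R}_{\ge0}^n$, outputs an allocation and payments $p_i(b)$; agent $i$'s utility is $v_i w(A_i(b))-p_i(b)$. DSIC: for every $i$, true $v_i$, $b_{-i}$, $b_i$, bidding $v_i$ gives at least the utility of bidding $b_i$, and truthful bidding gives nonnegative utility. *)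

(* Defs.v *)
From HB Require Import structures.
From mathcomp Require Import all_boot all_order all_algebra.
From mathcomp Require Import reals exp.
Set Implicit Arguments. Unset Strict Implicit. Unset Printing Implicit Defensive.
Import Order.TTheory GRing.Theory Num.Theory.
Local Open Scope ring_scope.

(* Model of computation: a unit-cost real RAM (BSS-style machine).          *)

Inductive instr :=
| IZero  (d : nat)
| IOne   (d : nat)
| IAdd   (d a b : nat)
| ISub   (d a b : nat)
| IMul   (d a b : nat)
| IDiv   (d a b : nat)
| ILoad  (d a : nat)
| IStore (a s : nat)
| IJle   (a b t : nat)
| IHalt.

Definition program := seq instr.

Section Machine.
Variable R : realType.

Record config := Config { pc : nat; mem : nat -> R }.

Definition upd (f : nat -> R) (k : nat) (x : R) : nat -> R :=
  fun j => if j == k then x else f j.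

Inductive step (P : program) : config -> config -> Prop :=
| StZero d pc0 m : nth IHalt P pc0 = IZero d -> (pc0 < size P)%N ->
    step P (Config pc0 m) (Config pc0.+1 (upd m d 0))
| StOne d pc0 m : nth IHalt P pc0 = IOne d -> (pc0 < size P)%N ->
    step P (Config pc0 m) (Config pc0.+1 (upd m d 1))
| StAdd d a b pc0 m : nth IHalt P pc0 = IAdd d a b -> (pc0 < size P)%N ->
    step P (Config pc0 m) (Config pc0.+1 (upd m d (m a + m b)))
| StSub d a b pc0 m : nth IHalt P pc0 = ISub d a b -> (pc0 < size P)%N ->
    step P (Config pc0 m) (Config pc0.+1 (upd m d (m a - m b)))
| StMul d a b pc0 m : nth IHalt P pc0 = IMul d a b -> (pc0 < size P)%N ->
    step P (Config pc0 m) (Config pc0.+1 (upd m d (m a * m b)))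
| StDiv d a b pc0 m : nth IHalt P pc0 = IDiv d a b -> (pc0 < size P)%N ->
    m b != 0 ->
    step P (Config pc0 m) (Config pc0.+1 (upd m d (m a / m b)))
| StLoad d a k pc0 m : nth IHalt P pc0 = ILoad d a -> (pc0 < size P)%N ->
    m a = k%:R ->
    step P (Config pc0 m) (Config pc0.+1 (upd m d (m k)))
| StStore a s k pc0 m : nth IHalt P pc0 = IStore a s -> (pc0 < size P)%N ->
    m a = k%:R ->
    step P (Config pc0 m) (Config pc0.+1 (upd m k (m s)))
| StJleT a b t pc0 m : nth IHalt P pc0 = IJle a b t -> (pc0 < size P)%N ->
    m a <= m b -> step P (Config pc0 m) (Config t m)
| StJleF a b t pc0 m : nth IHalt P pc0 = IJle a b t -> (pc0 < size P)%N ->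
    m b < m a -> step P (Config pc0 m) (Config pc0.+1 m).

Inductive steps (P : program) : nat -> config -> config -> Prop :=
| Steps0 c : steps P 0 c c
| StepsS k c c1 c2 : step P c c1 -> steps P k c1 c2 -> steps P k.+1 c c2.

Definition halted (P : program) (c : config) : Prop :=
  (pc c < size P)%N /\ nth IHalt P (pc c) = IHalt.

(* Input encoding of an instance (n, m, item weights w, bids b):
   r_0 = n, r_1 = m, r_(2+j) = w_j (j < m), r_(2+m+i) = b_i (i < n). *)
Definition init_mem (n m : nat) (w b : nat -> R) : nat -> R :=
  fun k => if k == 0%N then n%:R
           else if k == 1%N then m%:R
           else if (k < 2 + m)%N then w (k - 2)%N
           else if (k < 2 + m + n)%N then b (k - 2 - m)%N
           else 0.

(* Output encoding: on halting, r_(2+j) = A j (the agent receiving item j),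
   which must be a natural number < n, and r_(2+m+i) = p i (payment of i). *)
Definition decodes (n m : nat) (mm : nat -> R) (A : nat -> nat) (p : nat -> R)
  : Prop :=
  (forall j, (j < m)%N -> (A j < n)%N /\ mm (2 + j)%N = (A j)%:R) /\
  (forall i, (i < n)%N -> p i = mm (2 + m + i)%N).

Definition runs (P : program) (n m : nat) (w b : nat -> R) (T : nat)
    (A : nat -> nat) (p : nat -> R) : Prop :=
  exists k c, (k <= T)%N /\ steps P k (Config 0 (init_mem n m w b)) c /\
    halted P c /\ decodes n m (mem c) A p.

Definition outputs (P : program) (n m : nat) (w b : nat -> R)
    (A : nat -> nat) (p : nat -> R) : Prop :=
  exists T, runs P n m w b T A p.

(* The additive public function w is given by item weights w_j >= 0,        *)
(* w(S) = sum_(j in S) w_j.  An ordered n-partition of [m] is a map         *)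
(* A : [m] -> [n] (item j goes to bundle A j).                              *)

Definition nonneg_on (k : nat) (f : nat -> R) : Prop :=
  forall j, (j < k)%N -> 0 <= f j.

Definition is_partition (n m : nat) (A : nat -> nat) : Prop :=
  forall j, (j < m)%N -> (A j < n)%N.

Definition bundle_w (m : nat) (w : nat -> R) (A : nat -> nat) (i : nat) : R :=
  \sum_(j < m | A j == i) w j.

Definition NSW (n m : nat) (w v : nat -> R) (A : nat -> nat) : R :=
  powR (\prod_(i < n) (v i * bundle_w m w A i)) (n%:R^-1).

Definition setb (b : nat -> R) (i : nat) (x : R) : nat -> R :=
  fun j => if j == i then x else b j.

Definition poly_time (P : program) : Prop :=
  exists c k : nat, forall (n m : nat) (w b : nat -> R),
    (0 < n)%N -> nonneg_on m w -> nonneg_on n b ->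
    exists A p, runs P n m w b (c * (n + m) ^ k) A p.

Definition DSIC (P : program) : Prop :=
  forall (n m : nat) (w b : nat -> R) (i : nat) (vi bi : R)
         (A A' : nat -> nat) (p p' : nat -> R),
    (0 < n)%N -> nonneg_on m w -> nonneg_on n b -> (i < n)%N ->
    0 <= vi -> 0 <= bi ->
    outputs P n m w (setb b i vi) A p ->
    outputs P n m w (setb b i bi) A' p' ->
    vi * bundle_w m w A i - p i >= vi * bundle_w m w A' i - p' i /\
    vi * bundle_w m w A i - p i >= 0.

Definition approx_NSW (eps : R) (P : program) : Prop :=
  forall (n m : nat) (w v : nat -> R) (A : nat -> nat) (p : nat -> R),
    (0 < n)%N -> nonneg_on m w -> nonneg_on n v ->
    outputs P n m w v A p ->
    forall S : nat -> nat, is_partition n m S ->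
      NSW n m w v A >= (1 + eps)^-1 * NSW n m w v S.

End Machine.

(* Main.v *)
Require Import Defs.
From HB Require Import structures.
From mathcomp Require Import all_boot all_order all_algebra.
From mathcomp Require Import reals exp.
From mathcomp Require Import boolp.
From mathcomp Require Import zify ring lra.
Set Implicit Arguments. Unset Strict Implicit. Unset Printing Implicit Defensive.
Import Order.TTheory GRing.Theory Num.Theory.
Import Defs.
Local Open Scope ring_scope.

(** Since agents differ only by a factor [v i], the welfare is maximized by an allocation that does not depend on the bids, so charging nothing is truthful; what is needed is a polynomial-time scheme for maximizing the product of the loads [bundle_w].

In an optimal allocation with least load [l], removing any item of positive weight from a bundle leaves weight at most [l]. Hence an item heavier than [l] is alone, and every bundle has few items heavier than [l / q]. Round those items to multiples of [l / q ^ 2]; this leaves a number of bundle profiles bounded in terms of [q], and after sorting the agents by profile, the optimal allocation of the big items is described by boundedly many rules "each agent in the interval [a, b] takes an item of weight between [w l] and [w u]". All sets of rules are tried; no arithmetic on [q] or [l] is ever performed by the program. Small items are then given greedily to the least loaded agent. If [F] and [O] are the resulting and the optimal loads, the sum of [O i / F i] is at most [n (1 + 20 / q)], and the AM-GM inequality turns this into the product bound.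

The program is written in a small imperative language with bounded loops, which is compiled to the register machine; the running time is then polynomial by the shape of the program. *)

(** The cutoff [l / q] and the step [l / q ^ 2] are matched: a bundle has at most [q + 1] big items,
    so rounding costs it at most [2 * l / q], the order of the weight of one small item. This
    [2 / q], times the factor 10 lost by list scheduling, gives 20. Items heavier than [l] have no
    upper bound and cannot be rounded with bounded error. Each of them is alone in its bundle up to
    items of weight 0, so exchanging these items among their owners preserves the product; the
    optimum is compared with the computed allocation only after such an exchange. A rule stands for
    a triple: a profile, a level and a copy number. The number [Q] of rules depends on [q] alone, a
    rule is four indices below [n + m], and so there are [(n + m) ^ (4 * Q)] codes. The program
    never knows [l], but the items of one level are those between two item weights, which a code can
    name. Which item of the level is taken does not matter, since the analysis uses level counts
    only. *)

(** * Straight-line code of the machine *)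

Section StraightLineCode.
Variable R : realType.
Implicit Types (m : nat -> R) (i : instr) (l : seq instr).

(** The total counterpart of the partial relation [step]. An address is decoded by [truncn], which
    agrees with the machine under [safe1]; jumps and halts are left as no-ops and declared
    unsafe. *)
Definition exec1 i m : nat -> R :=
  match i with
  | IZero d => upd m d 0
  | IOne d => upd m d 1
  | IAdd d a b => upd m d (m a + m b)
  | ISub d a b => upd m d (m a - m b)
  | IMul d a b => upd m d (m a * m b)
  | IDiv d a b => upd m d (m a / m b)
  | ILoad d a => upd m d (m (Num.truncn (m a)))
  | IStore a s => upd m (Num.truncn (m a)) (m s)
  | _ => m
  end.

Definition safe1 i m : Prop :=
  match i with
  | IDiv d a b => m b != 0
  | ILoad _ a | IStore a _ => exists k : nat, m a = k%:R
  | IJle _ _ _ | IHalt => False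
  | _ => True
  end.

Fixpoint exec l m := if l is i :: l' then exec l' (exec1 i m) else m.

Fixpoint safe l m : Prop :=
  if l is i :: l' then safe1 i m /\ safe l' (exec1 i m) else True.

Lemma exec_cat l1 l2 m : exec (l1 ++ l2) m = exec l2 (exec l1 m).
Proof. by elim: l1 m => //= i l1 IH m; rewrite IH. Qed.

Lemma safe_cat l1 l2 m : safe (l1 ++ l2) m <-> safe l1 m /\ safe l2 (exec l1 m).
Proof.
elim: l1 m => [|i l1 IH] m /=; first by split=> [|[]].
by rewrite IH; split=> [[? []]|[[]]].
Qed.

Lemma steps_trans P j k c1 c2 c3 :
  steps P j c1 c2 -> steps P k c2 c3 -> steps P (j + k) (c1 : config R) c3.
Proof.
elim=> [//|{}j c c' c'' s1 _ IH] s2; rewrite addSn.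
by apply: StepsS s1 _; apply: IH.
Qed.

Lemma step_steps P (c1 c2 : config R) : step P c1 c2 -> steps P 1 c1 c2.
Proof. by move=> H; apply: StepsS H _; apply: Steps0. Qed.

Lemma step_exec1 pre i post m : safe1 i m ->
  step (pre ++ i :: post) (Config (size pre) m) (Config (size pre).+1 (exec1 i m)).
Proof.
have E : nth IHalt (pre ++ i :: post) (size pre) = i by rewrite nth_cat ltnn subnn.
have lt : (size pre < size (pre ++ i :: post))%N by rewrite size_cat /=; lia.
case: i E lt => //= [d|d|d a b|d a b|d a b|d a b|d a|a s] E lt.
- by move=> _; apply: StZero E lt.
- by move=> _; apply: StOne E lt.
- by move=> _; apply: StAdd E lt.
- by move=> _; apply: StSub E lt.
- by move=> _; apply: StMul E lt.
- by move=> b0; apply: StDiv E lt b0.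
- by case=> k mk; rewrite mk natrK; apply: StLoad E lt mk.
- by case=> k mk; rewrite mk natrK; apply: StStore E lt mk.
Qed.

Lemma steps_exec pre l post m : safe l m ->
  steps (pre ++ l ++ post) (size l) (Config (size pre) m)
    (Config (size pre + size l) (exec l m)).
Proof.
elim: l pre m => [|i l IH] pre m /=; first by rewrite addn0; constructor.
move=> [s1 s2]; apply: (StepsS (step_exec1 pre (l ++ post) s1)).
have := IH (rcons pre i) _ s2; rewrite size_rcons cat_rcons.
by rewrite addSn addnS.
Qed.

Lemma step_jle pre a b t post m :
  step (pre ++ IJle a b t :: post) (Config (size pre) m)
    (Config (if m a <= m b then t else (size pre).+1) m).
Proof.
have E : nth IHalt (pre ++ IJle a b t :: post) (size pre) = IJle a b t.
  by rewrite nth_cat ltnn subnn.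
have lt : (size pre < size (pre ++ IJle a b t :: post))%N.
  by rewrite size_cat /=; lia.
case: leP => ab; [exact: StJleT E lt ab | exact: StJleF E lt ab].
Qed.

Lemma eq_upd m k (x y : R) : x = y -> upd m k x = upd m k y.
Proof. by move=> ->. Qed.

Lemma upd_upd m k (x y : R) : upd (upd m k x) k y = upd m k y.
Proof. by apply/funext => j; rewrite /upd; case: eqP. Qed.

Lemma upd_id m k (x : R) : x = m k -> upd m k x = m.
Proof. by move=> ->; apply/funext => j; rewrite /upd; case: eqP => // ->. Qed.

Lemma updE m k (x : R) : upd m k x k = x.
Proof. by rewrite /upd eqxx. Qed.

Lemma updN m k (x : R) j : j != k -> upd m k x j = m j.
Proof. by rewrite /upd => /negbTE ->. Qed.

(** The only constants of the machine are 0 and 1, so a fixed multiple is obtained by repeating one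
    addition. *)
Lemma exec_addn k a b m : a != b ->
  exec (nseq k (IAdd a a b)) m = upd m a (m a + k%:R * m b).
Proof.
move=> ab; elim: k m => [|k IH] m /=; first by rewrite upd_id // mul0r addr0.
rewrite IH upd_upd updE updN; last by rewrite eq_sym.
by apply: eq_upd; rewrite -addn1 natrD; ring.
Qed.

Lemma exec_subn k a b m : a != b ->
  exec (nseq k (ISub a a b)) m = upd m a (m a - k%:R * m b).
Proof.
move=> ab; elim: k m => [|k IH] m /=; first by rewrite upd_id // mul0r subr0.
rewrite IH upd_upd updE updN; last by rewrite eq_sym.
by apply: eq_upd; rewrite -addn1 natrD; ring.
Qed.

Lemma exec_double k a m :
  exec (nseq k (IAdd a a a)) m = upd m a ((2 ^ k)%:R * m a).
Proof.
elim: k m => [|k IH] m /=; first by rewrite upd_id // mul1r.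
by rewrite IH upd_upd updE; apply: eq_upd; rewrite expnS natrM; ring.
Qed.

Lemma safe_nseq k i m :
  match i with IZero _ | IOne _ | IAdd _ _ _ | ISub _ _ _ | IMul _ _ _ => true
  | _ => false end -> safe (nseq k i) m.
Proof. by case: i => // *; elim: k m => //= k IH m; split. Qed.

End StraightLineCode.

(** * A language with bounded loops, and its compiler *)

(** Naturals and reals live in separate variables, so array indices are natural numbers by
    construction; this discharges the side conditions of [ILoad] and [IStore]. *)
Inductive cmd :=
| Skip
| Seq of cmd & cmd
| NZero of nat
| NInc of nat
| NMov of nat & nat
| DMov of nat & nat
| NDig of nat & nat
| RZero of nat
| ROne of nat
| RAdd of nat & nat
| RMul of nat & nat
| RCast of nat & nat
| NLd of nat & bool & nat
| NSt of bool & nat & nat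
| RLd of nat & bool & nat
| RSt of bool & nat & nat
| ILd of nat & nat
| ISt of nat & nat
| IfN of nat & nat & cmd & cmd
| IfR of nat & nat & cmd & cmd
| For of nat & cmd.

Definition fset {I : eqType} {T : Type} (f : I -> T) k x := fun j => if j == k then x else f j.

Lemma fsetE {I : eqType} {T : Type} (f : I -> T) k x : fset f k x k = x.
Proof. by rewrite /fset eqxx. Qed.

Lemma fsetN {I : eqType} {T : Type} (f : I -> T) k x j : j != k -> fset f k x j = f j.
Proof. by rewrite /fset => /negbTE ->. Qed.

Section Semantics.
Variable R : realType.

Record state := State {
  sn : nat -> nat; sr : nat -> R; dg : nat -> nat;
  na : bool -> nat -> nat; ra : bool -> nat -> R; inp : nat -> R }.

Definition setn s x v := State (fset (sn s) x v) (sr s) (dg s) (na s) (ra s) (inp s).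
Definition setr s x v := State (sn s) (fset (sr s) x v) (dg s) (na s) (ra s) (inp s).
Definition setd s x v := State (sn s) (sr s) (fset (dg s) x v) (na s) (ra s) (inp s).
Definition setna s a i v :=
  State (sn s) (sr s) (dg s) (fset (na s) a (fset (na s a) i v)) (ra s) (inp s).
Definition setra s a i v :=
  State (sn s) (sr s) (dg s) (na s) (fset (ra s) a (fset (ra s a) i v)) (inp s).
Definition seti s i v := State (sn s) (sr s) (dg s) (na s) (ra s) (fset (inp s) i v).

Variable N : nat.

(* [inp] stands for the input cells that lie above the registers; only its first [N] entries are accessible. *)
Fixpoint run (c : cmd) (s : state) : state :=
  match c with
  | Skip => s
  | Seq c1 c2 => run c2 (run c1 s)
  | NZero x => setn s x 0
  | NInc x => setn s x (sn s x).+1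
  | NMov x y => setn s x (sn s y)
  | DMov k x => setd s k (sn s x)
  | NDig x k => setn s x (dg s k)
  | RZero x => setr s x 0
  | ROne x => setr s x 1
  | RAdd x y => setr s x (sr s x + sr s y)
  | RMul x y => setr s x (sr s x * sr s y)
  | RCast x y => setr s x (sn s y)%:R
  | NLd x a i => setn s x (na s a (sn s i))
  | NSt a i x => setna s a (sn s i) (sn s x)
  | RLd x a i => setr s x (ra s a (sn s i))
  | RSt a i x => setra s a (sn s i) (sr s x)
  | ILd x i => if (sn s i < N)%N then setr s x (inp s (sn s i)) else s
  | ISt i x => if (sn s i < N)%N then seti s (sn s i) (sr s x) else s
  | IfN x y c1 c2 => if (sn s x <= sn s y)%N then run c1 s else run c2 s
  | IfR x y c1 c2 => if sr s x <= sr s y then run c1 s else run c2 s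
  | For x c => foldl (fun s i => run c (setn s x i)) s (iota 0 N)
  end.

(** The 7 covers the longest primitive: six instructions for an address and one access. An iteration
    adds a test, a copy of the counter, an increment and a jump; the 2 of a loop are its
    initialization and its last test. Both branches of a conditional are counted, which makes the
    bound independent of the state. *)
Fixpoint time (c : cmd) : nat :=
  match c with
  | Skip => 0
  | Seq c1 c2 => time c1 + time c2
  | IfN _ _ c1 c2 | IfR _ _ c1 c2 => 2 + (time c1 + time c2)
  | For _ c => 2 + N * (4 + time c)
  | _ => 7
  end%N.

End Semantics.

Arguments sn {R}. Arguments sr {R}. Arguments dg {R}. Arguments na {R}.
Arguments ra {R}. Arguments inp {R}.

(* Registers 0-5 hold 0, 1, N, the base B of the arrays, an address, and the number K of registers. *)
Definition rn x := (6 + 4 * x)%N.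
Definition rr x := (7 + 4 * x)%N.
Definition rd x := (8 + 4 * x)%N.
Definition rc x := (9 + 4 * x)%N.

(* Array element [i] is at address [B + 4 * i + off]. *)
Definition addr i off : seq instr :=
  [:: IAdd 4 (rn i) (rn i); IAdd 4 4 4; IAdd 4 4 3] ++ nseq off (IAdd 4 4 1).

(** Jumps are absolute, hence the argument [pc]. The nesting depth [d] gives each loop a counter
    [rc d] of its own, so a body may overwrite the loop variable. The else branch comes first
    because [IJle] jumps when the test succeeds; [IJle 0 0] always jumps. *)
Fixpoint compile (pc d : nat) (c : cmd) : seq instr :=
  match c with
  | Skip => [::]
  | Seq c1 c2 => let l1 := compile pc d c1 in l1 ++ compile (pc + size l1) d c2
  | NZero x => [:: IZero (rn x)]
  | NInc x => [:: IAdd (rn x) (rn x) 1]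
  | NMov x y => [:: IAdd (rn x) (rn y) 0]
  | DMov k x => [:: IAdd (rd k) (rn x) 0]
  | NDig x k => [:: IAdd (rn x) (rd k) 0]
  | RZero x => [:: IZero (rr x)]
  | ROne x => [:: IOne (rr x)]
  | RAdd x y => [:: IAdd (rr x) (rr x) (rr y)]
  | RMul x y => [:: IMul (rr x) (rr x) (rr y)]
  | RCast x y => [:: IAdd (rr x) (rn y) 0]
  | NLd x a i => addr i (2 + a) ++ [:: ILoad (rn x) 4]
  | NSt a i x => addr i (2 + a) ++ [:: IStore 4 (rn x)]
  | RLd x a i => addr i a ++ [:: ILoad (rr x) 4]
  | RSt a i x => addr i a ++ [:: IStore 4 (rr x)]
  | ILd x i => [:: IJle 2 (rn i) (pc + 3); IAdd 4 (rn i) 5; ILoad (rr x) 4]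
  | ISt i x => [:: IJle 2 (rn i) (pc + 3); IAdd 4 (rn i) 5; IStore 4 (rr x)]
  | IfN x y c1 c2 =>
      let l2 := compile pc.+1 d c2 in
      let l1 := compile (pc.+1 + size l2).+1 d c1 in
      IJle (rn x) (rn y) (pc.+1 + size l2).+1 :: l2 ++
      IJle 0 0 ((pc.+1 + size l2).+1 + size l1) :: l1
  | IfR x y c1 c2 =>
      let l2 := compile pc.+1 d c2 in
      let l1 := compile (pc.+1 + size l2).+1 d c1 in
      IJle (rr x) (rr y) (pc.+1 + size l2).+1 :: l2 ++
      IJle 0 0 ((pc.+1 + size l2).+1 + size l1) :: l1
  | For x c =>
      let l := compile pc.+3 d.+1 c in
      [:: IZero (rc d); IJle 2 (rc d) (pc.+3 + size l + 2); IAdd (rn x) (rc d) 0]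
      ++ l ++ [:: IAdd (rc d) (rc d) 1; IJle 0 0 pc.+1]
  end.

Fixpoint fits (V d : nat) (c : cmd) : bool :=
  match c with
  | Skip => true
  | Seq c1 c2 => fits V d c1 && fits V d c2
  | NZero x | NInc x | RZero x | ROne x => (x < V)%N
  | NMov x y | DMov x y | NDig x y | RAdd x y | RMul x y | RCast x y
  | NLd x _ y | NSt _ x y | RLd x _ y | RSt _ x y | ILd x y | ISt x y =>
      (x < V)%N && (y < V)%N
  | IfN x y c1 c2 | IfR x y c1 c2 =>
      [&& x < V, y < V, fits V d c1 & fits V d c2]%N
  | For x c => [&& x < V, d < V & fits V d.+1 c]%N
  end.

(** * Correctness of the compiler *)

Section CompilerCorrectness.
Variables (R : realType) (V N B : nat).
Let K := (6 + 4 * V)%N.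
Hypothesis KNB : (K + N <= B)%N.

(** Register 4 is unconstrained, being the scratch address, and so are the loop counters, which no
    state records. Interleaving the four arrays with stride 4 makes a length bound for them
    unnecessary. *)
Record rep (s : state R) (m : nat -> R) : Prop := Rep {
  rep0 : m 0%N = 0;
  rep1 : m 1%N = 1;
  repN : m 2%N = N%:R;
  repB : m 3%N = B%:R;
  repK : m 5%N = K%:R;
  repn : forall x, (x < V)%N -> m (rn x) = (sn s x)%:R;
  repr : forall x, (x < V)%N -> m (rr x) = sr s x;
  repd : forall x, (x < V)%N -> m (rd x) = (dg s x)%:R;
  repna : forall (a : bool) i, m (B + 4 * i + (2 + a))%N = (na s a i)%:R;
  repra : forall (a : bool) i, m (B + 4 * i + a)%N = ra s a i;
  repi : forall i, (i < N)%N -> m (K + i)%N = inp s i }.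

Ltac lia' := move: KNB; rewrite /rn /rr /rd /rc /K; lia.

Ltac frame_tac := solve [done | intros; rewrite updN; [by auto | lia']].

Lemma rep_tmp v s m : rep s m -> rep s (upd m 4 v).
Proof.
by move=> [h0 h1 hN hB hK hn hr hd hna hra hi]; split; frame_tac.
Qed.

Lemma rep_rc s m d v : (d < V)%N -> rep s m -> rep s (upd m (rc d) v).
Proof.
by move=> dV [h0 h1 hN hB hK hn hr hd hna hra hi]; split; frame_tac.
Qed.

Lemma rep_setn s m x v : (x < V)%N -> rep s m -> rep (setn s x v) (upd m (rn x) v%:R).
Proof.
move=> dV [h0 h1 hN hB hK hn hr hd hna hra hi]; split; try frame_tac.
move=> y yV; rewrite /= /fset; case: eqP => [->|ne]; first by rewrite updE.
by rewrite updN ?hn //; lia'.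
Qed.

Lemma rep_setr s m x v : (x < V)%N -> rep s m -> rep (setr s x v) (upd m (rr x) v).
Proof.
move=> dV [h0 h1 hN hB hK hn hr hd hna hra hi]; split; try frame_tac.
move=> y yV; rewrite /= /fset; case: eqP => [->|ne]; first by rewrite updE.
by rewrite updN ?hr //; lia'.
Qed.

Lemma rep_setd s m x v : (x < V)%N -> rep s m -> rep (setd s x v) (upd m (rd x) v%:R).
Proof.
move=> dV [h0 h1 hN hB hK hn hr hd hna hra hi]; split; try frame_tac.
move=> y yV; rewrite /= /fset; case: eqP => [->|ne]; first by rewrite updE.
by rewrite updN ?hd //; lia'.
Qed.

Lemma rep_setna s m (a : bool) j v :
  rep s m -> rep (setna s a j v) (upd m (B + 4 * j + (2 + a))%N v%:R).
Proof.
move=> [h0 h1 hN hB hK hn hr hd hna hra hi]; split; try frame_tac.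
move=> b i; rewrite /= /fset; case: eqP => [->|ba]; last first.
  by rewrite updN ?hna //; case: (a) (b) ba => [] [] // _; lia'.
case: eqP => [->|ne]; first by rewrite updE.
by rewrite updN ?hna //; lia'.
Qed.

Lemma rep_setra s m (a : bool) j v :
  rep s m -> rep (setra s a j v) (upd m (B + 4 * j + a)%N v).
Proof.
move=> [h0 h1 hN hB hK hn hr hd hna hra hi]; split; try frame_tac.
move=> b i; rewrite /= /fset; case: eqP => [->|ba]; last first.
  by rewrite updN ?hra //; case: (a) (b) ba => [] [] // _; lia'.
case: eqP => [->|ne]; first by rewrite updE.
by rewrite updN ?hra //; lia'.
Qed.

Lemma rep_seti s m j v :
  (j < N)%N -> rep s m -> rep (seti s j v) (upd m (K + j)%N v).
Proof.
move=> jN [h0 h1 hN hB hK hn hr hd hna hra hi]; split; try frame_tac.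
move=> i iN; rewrite /= /fset; case: eqP => [->|ne]; first by rewrite updE.
by rewrite updN ?hi //; lia'.
Qed.

Lemma exec_addr s m i off : rep s m -> (i < V)%N ->
  exec (addr i off) m = upd m 4 (B + 4 * sn s i + off)%:R.
Proof.
move=> r iV; rewrite /addr exec_cat exec_addn //= !upd_upd !updE !updN //.
rewrite (repB r) (rep1 r) (repn r) //; apply: eq_upd.
by have := natrM R 4 (sn s i); rewrite (natrD _ (B + _)) (natrD _ B) => ->; ring.
Qed.

Lemma safe_addr (m : nat -> R) i off : safe (addr i off) m.
Proof. by rewrite /addr safe_cat; split=> //; apply: safe_nseq. Qed.

Lemma size_addr i (off : nat) z : size (addr i off ++ [:: z]) = (off + 4)%N.
Proof. by rewrite size_cat /addr size_cat size_nseq /=; lia. Qed.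

Lemma safe_addr_cat (m : nat -> R) i off z :
  safe1 z (exec (addr i off) m) -> safe (addr i off ++ [:: z]) m.
Proof. by move=> H; apply/safe_cat; split=> //; exact: safe_addr. Qed.

Opaque addr.

(** Arbitrary surrounding code makes fragments composable; the last clause protects the counters of
    the enclosing loops. *)
Definition simulates (l : seq instr) (p d T : nat) (s s' : state R) :=
  forall pre post m, size pre = p -> rep s m -> exists k m',
    [/\ (k <= T)%N,
        steps (pre ++ l ++ post) k (Config p m) (Config (p + size l) m'),
        rep s' m' & forall e, (e < d)%N -> m' (rc e) = m (rc e)].

Lemma simulates_exec l p d T s s' : (size l <= T)%N ->
  (forall m, rep s m -> [/\ safe l m, rep s' (exec l m) &
     forall e, (e < d)%N -> exec l m (rc e) = m (rc e)]) ->
  simulates l p d T s s'.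
Proof.
move=> lT H pre post m <- r; have [h1 h2 h3] := H m r.
by exists (size l), (exec l m); split=> //; apply: steps_exec.
Qed.

Lemma simulates_cat l1 l2 p d T1 T2 s1 s2 s3 :
  simulates l1 p d T1 s1 s2 -> simulates l2 (p + size l1) d T2 s2 s3 ->
  simulates (l1 ++ l2) p d (T1 + T2) s1 s3.
Proof.
move=> H1 H2 pre post m sp r.
have [k1 [m1 [kT1 st1 r1 e1]]] := H1 pre (l2 ++ post) m sp r.
have [|k2 [m2 [kT2 st2 r2 e2]]] := H2 (pre ++ l1) post m1 _ r1.
  by rewrite size_cat sp.
exists (k1 + k2)%N, m2; split=> //; first lia.
- apply: steps_trans; first by rewrite -catA; exact: st1.
  by rewrite size_cat addnA -!catA; rewrite -!catA in st2.
- by move=> e ed; rewrite e2 // e1.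
Qed.

Lemma simulates_if (b : bool) x y l1 l2 p d T1 T2 s s1 s2 :
  (forall m, rep s m -> (m x <= m y) = b) ->
  simulates l2 p.+1 d T2 s s2 ->
  simulates l1 (p.+1 + size l2).+1 d T1 s s1 ->
  simulates (IJle x y (p.+1 + size l2).+1 :: l2 ++
      IJle 0 0 ((p.+1 + size l2).+1 + size l1) :: l1)
    p d (2 + (T1 + T2)) s (if b then s1 else s2).
Proof.
move=> Hb H2 H1 pre post m sp r.
set i1 := IJle x y _; set i2 := IJle 0 0 _.
have st : forall post', step (pre ++ i1 :: post') (Config p m)
    (Config (if b then (p.+1 + size l2).+1 else p.+1) m).
  move=> post'; have := step_jle pre x y (p.+1 + size l2).+1 post' m.
  by rewrite Hb // sp.
case: b st {Hb} => st.
- have [|k [m' [kT st1 r1 e1]]] := H1 (pre ++ i1 :: l2 ++ [:: i2]) post m _ r.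
    by rewrite !size_cat /= ?size_cat /= sp; lia.
  exists k.+1, m'; split=> //; first lia.
  apply: StepsS; first exact: st.
  rewrite -!catA /= -?catA /= in st1.
  rewrite /= !size_cat /= -catA /=; move: st1; congr (steps _ _ _ (Config _ _)).
  lia.
- have [|k [m' [kT st1 r1 e1]]] := H2 (pre ++ [:: i1]) (i2 :: l1 ++ post) m _ r.
    by rewrite !size_cat /= ?size_cat /= sp; lia.
  exists (1 + (k + 1))%N, m'; split=> //; first lia.
  apply: StepsS; first exact: st.
  rewrite -!catA /= -?catA /= in st1.
  rewrite /= -?catA /=; apply: steps_trans; first exact: st1.
  have := step_jle (pre ++ i1 :: l2) 0 0 ((p.+1 + size l2).+1 + size l1) (l1 ++ post) m'.
  rewrite lexx -!catA /= => st3; apply: step_steps; move: st3.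
  by rewrite !size_cat /= sp; congr (step _ (Config _ _) (Config _ _)); lia.
Qed.

Lemma simulates_for x l p d T s (f : state R -> state R) :
  (x < V)%N -> (d < V)%N ->
  (forall s', simulates l p.+3 d.+1 T s' (f s')) ->
  simulates ([:: IZero (rc d); IJle 2 (rc d) (p.+3 + size l + 2); IAdd (rn x) (rc d) 0]
      ++ l ++ [:: IAdd (rc d) (rc d) 1; IJle 0 0 p.+1])
    p d (2 + N * (4 + T)) s (foldl (fun s i => f (setn s x i)) s (iota 0 N)).
Proof.
move=> xV dV H pre post m sp r.
set i1 := IZero _; set i2 := IJle 2 _ _; set i3 := IAdd (rn x) _ _.
set i4 := IAdd (rc d) _ _; set i5 := IJle 0 0 _.
set P := pre ++ _.
(* Induction on the number [j] of iterations left, with [i] in the counter. *)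
have loop : forall j i s' m', rep s' m' -> m' (rc d) = i%:R -> (i + j = N)%N ->
  exists k m'', [/\ (k <= 1 + j * (4 + T))%N,
    steps P k (Config p.+1 m') (Config (p.+3 + size l + 2) m''),
    rep (foldl (fun s i => f (setn s x i)) s' (iota i j)) m'' &
    forall e, (e < d)%N -> m'' (rc e) = m' (rc e)].
  elim=> [|j IH] i s' m' r' mi ij.
    exists 1%N, m'; split=> //.
    have := step_jle (pre ++ [:: i1]) 2 (rc d) (p.+3 + size l + 2)
      (i3 :: (l ++ [:: i4; i5]) ++ post) m'.
    rewrite (repN r') mi -ij addn0 lexx -catA /= => st.
    by apply: step_steps; move: st; rewrite size_cat /= sp addn1.
  pose m1 := upd m' (rn x) i%:R.
  have r1 : rep (setn s' x i) m1 by apply: rep_setn.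
  have [|k [m2 [kT st2 r2 e2]]] := H (setn s' x i) (pre ++ [:: i1; i2; i3])
      (i4 :: i5 :: post) m1 _ r1; first by rewrite size_cat /= sp; lia.
  have m2d : m2 (rc d) = i%:R.
    rewrite e2 // /m1 updN ?mi //; lia'.
  pose m3 := upd m2 (rc d) (i.+1)%:R.
  have r3 : rep (f (setn s' x i)) m3 by apply: rep_rc.
  have [||k' [m4 [kT' st4 r4 e4]]] := IH i.+1 _ m3 r3.
  - by rewrite /m3 updE.
  - by lia.
  exists (1 + (1 + (k + (1 + (1 + k')))))%N, m4; split=> //.
  - by lia.
  - apply: (@steps_trans _ _ _ _ _ (Config p.+2 m')).
      have := step_jle (pre ++ [:: i1]) 2 (rc d) (p.+3 + size l + 2)
        (i3 :: (l ++ [:: i4; i5]) ++ post) m'.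
      rewrite (repN r') mi ler_nat leqNgt; have -> : (i < N)%N by lia.
      rewrite -catA /= => st.
      by apply: step_steps; move: st; rewrite size_cat /= sp addn1.
    apply: (@steps_trans _ _ _ _ _ (Config p.+3 m1)).
      have := @step_exec1 R (pre ++ [:: i1; i2]) i3 ((l ++ [:: i4; i5]) ++ post) m' I.
      rewrite /= (rep0 r') mi addr0 -catA /= => st.
      by apply: step_steps; move: st; rewrite size_cat /= sp addn2.
    apply: (@steps_trans _ _ _ _ _ (Config (p.+3 + size l) m2)).
      by move: st2; rewrite /P -!catA /=.
    apply: (@steps_trans _ _ _ _ _ (Config (p.+3 + size l).+1 m3)).
      have := @step_exec1 R (pre ++ [:: i1, i2, i3 & l]) i4 (i5 :: post) m2 I.
      rewrite /= (rep1 r2) m2d -(natrD _ i 1) addn1 -catA /= => st.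
      apply: step_steps; move: st; rewrite size_cat /= sp /P -!catA /=.
      by congr (step _ (Config _ _) (Config _ _)); lia.
    apply: (@steps_trans _ _ _ _ _ (Config p.+1 m3)) st4.
      have := step_jle (pre ++ [:: i1, i2, i3 & l ++ [:: i4]]) 0 0 p.+1 post m3.
      rewrite lexx -!catA /= -?catA /= => st.
      apply: step_steps; move: st; rewrite !size_cat /= ?size_cat /= sp /P -!catA /=.
      by congr (step _ (Config _ _) (Config _ _)); lia.
  - move=> e ed; rewrite e4 // /m3 updN; last lia'.
    by rewrite e2; [rewrite /m1 updN //; lia' | lia].
have r0 : rep s (upd m (rc d) 0) by apply: rep_rc.
have [||k [m' [kT st r' e']]] := loop N 0%N s _ r0.
- by rewrite updE.
- by [].
exists k.+1, m'; split=> //.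
- apply: (@StepsS _ _ _ _ (Config p.+1 (upd m (rc d) 0))).
    by have := @step_exec1 R pre i1 (i2 :: i3 :: (l ++ [:: i4; i5]) ++ post) m I; rewrite sp.
  move: st; congr (steps _ _ _ (Config _ _)).
  by rewrite /= size_cat /=; lia.
- by move=> e ed; rewrite e' // updN //; lia'.
Qed.

Lemma compile_simulates c p d s : fits V d c -> (d <= V)%N ->
  simulates (compile p d c) p d (time N c) s (run N c s).
Proof.
elim: c p d s => [|c1 IH1 c2 IH2|x|x|x y|k x|x k|x|x|x y|x y|x y|x a i|a i x|x a i|a i x|x i|i x|x y c1 IH1 c2 IH2|x y c1 IH1 c2 IH2|x c IH] p d s /=.
- by move=> _ _; apply: simulates_exec => // m r.
- by case/andP=> f1 f2 dV; apply: simulates_cat; [exact: IH1|exact: IH2].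
- move=> xV dV; apply: simulates_exec => // m r; split=> //=.
    exact: (@rep_setn _ _ _ 0%N).
  by move=> e ed; rewrite updN //; lia'.
- move=> xV dV; apply: simulates_exec => // m r; split=> //=.
    rewrite (repn r) // (rep1 r) -(natrD _ _ 1) addn1; exact: rep_setn.
  by move=> e ed; rewrite updN //; lia'.
- case/andP=> xV yV dV; apply: simulates_exec => // m r; split=> //=.
    rewrite (repn r) // (rep0 r) addr0; exact: rep_setn.
  by move=> e ed; rewrite updN //; lia'.
- case/andP=> xV yV dV; apply: simulates_exec => // m r; split=> //=.
    rewrite (repn r) // (rep0 r) addr0; exact: rep_setd.
  by move=> e ed; rewrite updN //; lia'.
- case/andP=> xV yV dV; apply: simulates_exec => // m r; split=> //=.
    rewrite (repd r) // (rep0 r) addr0; exact: rep_setn.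
  by move=> e ed; rewrite updN //; lia'.
- move=> xV dV; apply: simulates_exec => // m r; split=> //=.
    exact: rep_setr.
  by move=> e ed; rewrite updN //; lia'.
- move=> xV dV; apply: simulates_exec => // m r; split=> //=.
    exact: rep_setr.
  by move=> e ed; rewrite updN //; lia'.
- case/andP=> xV yV dV; apply: simulates_exec => // m r; split=> //=.
    rewrite !(repr r) //; exact: rep_setr.
  by move=> e ed; rewrite updN //; lia'.
- case/andP=> xV yV dV; apply: simulates_exec => // m r; split=> //=.
    rewrite !(repr r) //; exact: rep_setr.
  by move=> e ed; rewrite updN //; lia'.
- case/andP=> xV yV dV; apply: simulates_exec => // m r; split=> //=.
    rewrite (repn r) // (rep0 r) addr0; exact: rep_setr.
  by move=> e ed; rewrite updN //; lia'.
- case/andP=> xV iV dV; apply: simulates_exec => [|m r].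
    by rewrite size_addr; case: a.
  rewrite exec_cat (exec_addr _ r) //=.
  have r' := rep_tmp (B + 4 * sn s i + (2 + a))%:R r.
  rewrite updE natrK (repna r'); split.
  + by apply: safe_addr_cat; rewrite (exec_addr _ r) //= updE; eexists.
  + exact: rep_setn.
  + by move=> e ed; rewrite !updN //; lia'.
- case/andP=> iV xV dV; apply: simulates_exec => [|m r].
    by rewrite size_addr; case: a.
  rewrite exec_cat (exec_addr _ r) //=.
  have r' := rep_tmp (B + 4 * sn s i + (2 + a))%:R r.
  rewrite updE natrK (repn r') //; split.
  + by apply: safe_addr_cat; rewrite (exec_addr _ r) //= updE; eexists.
  + exact: rep_setna.
  + by move=> e ed; rewrite !updN //; lia'.
- case/andP=> xV iV dV; apply: simulates_exec => [|m r].
    by rewrite size_addr; case: a.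
  rewrite exec_cat (exec_addr _ r) //=.
  have r' := rep_tmp (B + 4 * sn s i + a)%:R r.
  rewrite updE natrK (repra r'); split.
  + by apply: safe_addr_cat; rewrite (exec_addr _ r) //= updE; eexists.
  + exact: rep_setr.
  + by move=> e ed; rewrite !updN //; lia'.
- case/andP=> iV xV dV; apply: simulates_exec => [|m r].
    by rewrite size_addr; case: a.
  rewrite exec_cat (exec_addr _ r) //=.
  have r' := rep_tmp (B + 4 * sn s i + a)%:R r.
  rewrite updE natrK (repr r') //; split.
  + by apply: safe_addr_cat; rewrite (exec_addr _ r) //= updE; eexists.
  + exact: rep_setra.
  + by move=> e ed; rewrite !updN //; lia'.
- case/andP=> xV iV dV pre post m sp r.
  have st1 := step_jle pre 2 (rn i) (p + 3) [:: IAdd 4 (rn i) 5, ILoad (rr x) 4 & post] m.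
  move: st1; rewrite (repN r) (repn r) // ler_nat sp.
  case: ltnP => iN st1.
    have r' := rep_tmp (K + sn s i)%:R r.
    exists 3%N, (upd (upd m 4 (K + sn s i)%:R) (rr x) (inp s (sn s i))); split=> //.
    + apply: StepsS st1 _.
      have := @steps_exec R (pre ++ [:: IJle 2 (rn i) (p + 3)])
        [:: IAdd 4 (rn i) 5; ILoad (rr x) 4] post m.
      rewrite /= size_cat sp addn1 -catA /= => /(_ _).
      rewrite (repn r) // (repK r) updE -natrD addnC natrK (repi r') //.
      rewrite /= (_ : p.+1 + 2 = p + 3)%N; last lia.
      by apply; split=> //; split=> //; eexists.
    + exact: rep_setr.
    + by move=> e ed; rewrite !updN //; lia'.
  by exists 1%N, m; split=> //; apply: step_steps.
- case/andP=> iV xV dV pre post m sp r.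
  have st1 := step_jle pre 2 (rn i) (p + 3) [:: IAdd 4 (rn i) 5, IStore 4 (rr x) & post] m.
  move: st1; rewrite (repN r) (repn r) // ler_nat sp.
  case: ltnP => iN st1.
    have r' := rep_tmp (K + sn s i)%:R r.
    exists 3%N, (upd (upd m 4 (K + sn s i)%:R) (K + sn s i)%N (sr s x)); split=> //.
    + apply: StepsS st1 _.
      have := @steps_exec R (pre ++ [:: IJle 2 (rn i) (p + 3)])
        [:: IAdd 4 (rn i) 5; IStore 4 (rr x)] post m.
      rewrite /= size_cat sp addn1 -catA /= => /(_ _).
      rewrite (repn r) // (repK r) updE -natrD addnC natrK (repr r') //.
      rewrite /= (_ : p.+1 + 2 = p + 3)%N; last lia.
      by apply; split=> //; split=> //; eexists.
    + exact: rep_seti.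
    + by move=> e ed; rewrite !updN //; lia'.
  by exists 1%N, m; split=> //; apply: step_steps.
- case/and4P=> xV yV f1 f2 dV; apply: simulates_if; [|exact: IH2|exact: IH1].
  by move=> m r; rewrite !(repn r) // ler_nat.
- case/and4P=> xV yV f1 f2 dV; apply: simulates_if; [|exact: IH2|exact: IH1].
  by move=> m r; rewrite !(repr r).
- case/and3P=> xV d1V f1 dV; apply: (@simulates_for _ _ _ _ _ _ (run N c)) => // s'.
  exact: IH.
Qed.

End CompilerCorrectness.

(** * Moving input and output out of the way of the registers *)

Lemma init_mem_eq0 (R : realType) n m (w b : nat -> R) j :
  (2 + (n + m) <= j)%N -> init_mem n m w b j = 0.
Proof. by move=> h; rewrite /init_mem; do 4 (case: ifP => [/eqP|] ?; first lia). Qed.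

Section WholeProgram.
Variables (R : realType) (V K : nat).
Hypothesis V2 : (1 < V)%N.
Hypothesis KE : K = (6 + 4 * V)%N.

Definition save_registers : seq instr :=
  flatten [seq nseq 4 (IAdd 0 0 2) ++ [:: IStore 0 k] | k <- iota 3 (K - 3)].

(* The input occupies the low cells: cells [2 .. K-1] are moved to the array at the address [B = 2 ^ K * N], with cells 0 to 2 as only workspace; [N] is then recovered as [B / 2 ^ K]. *)
Definition prologue : seq instr :=
  ([:: IAdd 0 0 1] ++ nseq K (IAdd 0 0 0)) ++
  ([:: IStore 0 2; IOne 2] ++ save_registers) ++
  nseq (4 * (K - 3)) (ISub 0 0 2) ++
  ([:: IZero 3; IAdd 3 3 0; IOne 4] ++ nseq K (IAdd 4 4 4) ++ [:: IDiv 4 0 4]) ++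
  [seq IZero k | k <- iota 5 (K - 5)] ++
  [:: ISub 6 4 1; IAdd 10 10 1; IZero 2; IAdd 2 2 4; IZero 4; IOne 1; IZero 0] ++
  nseq K (IAdd 5 5 1).

Definition restore_registers : seq instr :=
  flatten [seq ILoad k 0 :: nseq 4 (IAdd 0 0 1) | k <- iota 2 (K - 2)].

Definition epilogue : seq instr :=
  [:: IAdd 0 0 3] ++ nseq 3 (IAdd 0 0 1) ++ restore_registers.

Definition whole (c : cmd) : program :=
  prologue ++ compile (size prologue) 0 c ++ epilogue ++ [:: IHalt].

Section Run.
Variables (n m : nat) (w b : nat -> R).
Hypothesis n0 : (0 < n)%N.
Let N := (n + m)%N.
Variable B : nat.
Hypothesis BE : B = (2 ^ K * N)%N.
Let m0 := init_mem n m w b.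

Definition input_state : state R :=
  State (fset (fset (fun=> 0%N) 0 n) 1 m) (fun=> 0) (fun=> 0%N) (fun _ _ => 0%N)
    (fun a i => if ~~ a && (i < K - 2)%N then m0 (2 + i)%N else 0)
    (fun i => m0 (K + i)%N).

Lemma far_base : (K + N <= B)%N.
Proof.
have : (K < 2 ^ K)%N by apply: ltn_expl.
have : (0 < N)%N by rewrite /N; lia.
by rewrite BE; nia.
Qed.

Let init_mem_far j : (2 + N <= j)%N -> m0 j = 0.
Proof. exact: init_mem_eq0. Qed.

(** Cell 2 is already saved at [B] and now holds the constant 1 by which the pointer in cell 0
    advances; hence the loop starts at cell 3. The targets lie above all cells still to be read. *)
Lemma exec_save_registers mm : mm 0%N = B%:R -> mm 2%N = 1 ->
  mm B = m0 2%N -> (forall j, (2 < j)%N -> j != B -> mm j = m0 j) ->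
  let mm' := exec save_registers mm in
  [/\ safe save_registers mm, mm' 0%N = (B + 4 * (K - 3))%:R,
      mm' 1%N = mm 1%N, mm' 2%N = 1 &
      (forall i, (2 + i < K)%N -> mm' (B + 4 * i)%N = m0 (2 + i)%N) /\
      (forall j, (2 < j)%N -> (forall i, (2 + i < K)%N -> j <> (B + 4 * i)%N) -> mm' j = m0 j)].
Proof.
move=> e0 e2 eB eo; cbv zeta. have KB := far_base.
rewrite /save_registers.
suff loop j k mm1 : mm1 0%N = (B + 4 * (k - 3))%:R -> mm1 1%N = mm 1%N -> mm1 2%N = 1 ->
   (2 < k)%N -> (k + j = K)%N ->
   (forall i, (2 + i < k)%N -> mm1 (B + 4 * i)%N = m0 (2 + i)%N) ->
   (forall j, (2 < j)%N -> (forall i, (2 + i < k)%N -> j <> (B + 4 * i)%N) -> mm1 j = m0 j) ->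
   let l := flatten [seq nseq 4 (IAdd 0 0 2) ++ [:: IStore 0 k0] | k0 <- iota k j] in
   let mm' := exec l mm1 in
   [/\ safe l mm1, mm' 0%N = (B + 4 * (K - 3))%:R,
      mm' 1%N = mm 1%N, mm' 2%N = 1 &
      (forall i, (2 + i < K)%N -> mm' (B + 4 * i)%N = m0 (2 + i)%N) /\
      (forall j, (2 < j)%N -> (forall i, (2 + i < K)%N -> j <> (B + 4 * i)%N) -> mm' j = m0 j)].
  apply: (loop (K - 3)%N 3%N) => //.
  - by rewrite e0 subnn muln0 addn0.
  - by lia.
  - move=> i i1; have -> : i = 0%N by lia.
    by rewrite muln0 !addn0 eB.
  - move=> j j2 jB; rewrite eo //; apply/eqP => E; apply: (jB 0%N) => //.
    by rewrite muln0 addn0.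
elim: j k mm1 => [|j IH] k mm1 h0 h1 h2 k2 kj hB ho.
  by move: h0 hB ho => /=; have -> : k = K by lia.
cbv zeta; set l := flatten _.
have -> : l = (nseq 4 (IAdd 0 0 2) ++ [:: IStore 0 k]) ++
   flatten [seq nseq 4 (IAdd 0 0 2) ++ [:: IStore 0 k0] | k0 <- iota k.+1 j] by [].
move: (flatten _) (IH k.+1) => {l} l' {}IH.
have E4 : exec (nseq 4 (IAdd 0 0 2)) mm1 = upd mm1 0 (B + 4 * (k - 2))%:R.
  rewrite exec_addn // h0 h2; apply: eq_upd.
  rewrite (_ : (B + 4 * (k - 2) = B + 4 * (k - 3) + 4)%N); last lia.
  by rewrite (natrD _ (B + _)); ring.
pose mm2 := exec [:: IStore 0 k] (upd mm1 0 (B + 4 * (k - 2))%:R).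
have S2 : safe (nseq 4 (IAdd 0 0 2) ++ [:: IStore 0 k]) mm1.
  apply/safe_cat; split; first exact: safe_nseq.
  by rewrite E4 /= updE; split=> //; eexists.
rewrite !exec_cat E4 -/mm2.
have E2 : mm2 = upd (upd mm1 0 (B + 4 * (k - 2))%:R) (B + 4 * (k - 2)) (mm1 k).
  by rewrite /mm2 /= updE natrK updN //; lia.
have [|||||||s r0 r1 r2 [rB ro]] := IH mm2.
- by rewrite E2 updN ?updE //; lia.
- by rewrite E2 !updN //; lia.
- by rewrite E2 !updN //; lia.
- by lia.
- by lia.
- move=> i ik; rewrite E2; case: (leqP k (2 + i)) => ki.
    rewrite (_ : i = k - 2)%N; last lia.
    by rewrite updE ho ?subnKC //; [lia|move=> i' h'; lia].
  by rewrite !updN ?hB //; lia.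
- move=> x x2 xB; rewrite E2 !updN; first 1 last.
  + by lia.
  + by apply/eqP; apply: xB; lia.
  by apply: ho => // i ik; apply: xB; lia.
split=> //; apply/safe_cat; split=> //.
by rewrite exec_cat E4.
Qed.

Lemma exec_zero l mm j : exec [seq IZero k | k <- l] mm j = if j \in l then 0 else mm j :> R.
Proof.
elim: l mm => //= k l IH mm; rewrite IH in_cons /upd.
by case: (j \in l); case: eqP.
Qed.

Lemma safe_zero l (mm : nat -> R) : safe [seq IZero k | k <- l] mm.
Proof. by elim: l mm. Qed.

Lemma prologue_correct : safe prologue m0 /\ rep V N B input_state (exec prologue m0).
Proof.
have KB := far_base; have hN : N = (n + m)%N by [].
have N0 : (0 < N)%N by lia.
have i0 : m0 0%N = n%:R by [].
have i1 : m0 1%N = m%:R by [].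
rewrite /prologue; set P1 := _ ++ nseq K _; set P2 := [:: _; _] ++ save_registers.
set P3 := nseq (4 * _) _; set P4 := [:: IZero 3, _ & _] ++ _; set P5 := map _ _.
set P6 := [:: ISub _ _ _, _ & _] ++ _.
have [m1 m1E] : {x | x = exec P1 m0} by eexists.
have E1 : m1 = upd m0 0 B%:R.
  rewrite m1E /P1 exec_cat exec_double /= upd_upd updE i0 i1 -natrD.
  by rewrite -natrM -BE.
have S1 : safe P1 m0 by split=> //; apply: safe_nseq.
pose mm := upd (upd m1 B (m0 2%N)) 2 1.
have [||||sv s0 s1 s2 [sB so]] := @exec_save_registers mm.
- by rewrite /mm E1 updN // updN ?updE //; lia.
- by rewrite /mm updE.
- by rewrite /mm updN ?updE //; lia.
- by move=> j j2 jB; rewrite /mm E1 !updN //; lia.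
have [m2 m2E] : {x | x = exec P2 m1} by eexists.
have E2 : m2 = exec save_registers mm.
  rewrite m2E /P2 exec_cat; congr (exec _ _).
  by rewrite /= /mm E1 updE natrK updN.
have S2 : safe P2 m1.
  rewrite /P2; apply: (proj2 (safe_cat _ _ _)); split.
    by split; [exists B; rewrite E1 updE|split].
  move: sv; congr (safe _ _).
  by rewrite /= /mm E1 updE natrK updN.
have [m3 m3E] : {x | x = exec P3 m2} by eexists.
have E3 : m3 = upd m2 0 B%:R.
  rewrite m3E /P3 exec_subn // E2 s0 s2 mulr1; apply: eq_upd.
  by rewrite natrD addrK.
have S3 : safe P3 m2 by apply: safe_nseq.
have [m4 m4E] : {x | x = exec P4 m3} by eexists.
have p2 : (2 ^ K)%:R != 0 :> R by rewrite pnatr_eq0 expn_eq0.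
have E4 : m4 = upd (upd m3 3 B%:R) 4 N%:R.
  rewrite m4E /P4 /= exec_cat exec_double /= !upd_upd !updE.
  rewrite !updN // E3 updE add0r mulr1; apply: eq_upd.
  by rewrite BE natrM mulrC mulKf.
have S4 : safe P4 m3.
  rewrite /P4 /=; do 3 split=> //; apply/safe_cat; split; first exact: safe_nseq.
  by rewrite exec_double /= updE updE mulr1.
have [m5 m5E] : {x | x = exec P5 m4} by eexists.
have E5 j : m5 j = if (4 < j < K)%N then 0 else m4 j.
  rewrite m5E /P5 exec_zero mem_iota (_ : 5 + (K - 5) = K)%N //.
  by lia.
have S5 : safe P5 m4 by apply: safe_zero.
have S6 : safe P6 m5 by rewrite /P6 /=; do 7 split=> //; apply: safe_nseq.
have K10 : (13 < K)%N by lia.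
have [m6 m6E] : {x | x = exec P6 m5} by eexists.
(* Cell 0 was overwritten, but cell 1 still holds [m], so [n] is recovered as [N - m]. Cells 6 and
   10 are the natural variables 0 and 1. *)
have E6 : m6 = upd (upd (upd (upd (upd (upd (upd m5 6 n%:R) 10 m%:R) 2 N%:R) 4 0) 1 1) 0 0) 5 K%:R.
  have v4 : m5 4%N = N%:R by rewrite E5 /= E4 updE.
  have v1 : m5 1%N = m%:R.
    by rewrite E5 /= E4 E3 E2 !updN // s1 /mm E1 !updN //; lia.
  have v10 : m5 10%N = 0 by rewrite E5 ifT //; lia.
  have v5 : m5 5%N = 0 by rewrite E5 ifT //; lia.
  rewrite m6E /P6 exec_cat exec_addn // /=; apply/funext => j; rewrite /upd /=.
  rewrite v4 v1 v10 v5 hN natrD addrK !add0r mulr1.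
  by do 7 (case: eqP => // _).
split.
  apply: (proj2 (safe_cat _ _ _)); split; [exact: S1|rewrite -m1E].
  apply: (proj2 (safe_cat _ _ _)); split; [exact: S2|rewrite -m2E].
  apply: (proj2 (safe_cat _ _ _)); split; [exact: S3|rewrite -m3E].
  apply: (proj2 (safe_cat _ _ _)); split; [exact: S4|rewrite -m4E].
  by apply: (proj2 (safe_cat _ _ _)); split; [exact: S5|rewrite -m5E].
rewrite 5!exec_cat -m1E -m2E -m3E -m4E -m5E -m6E.
have far j : (K <= j)%N -> m6 j = m2 j.
  move=> Kj; rewrite E6 !updN; try by lia.
  rewrite E5 ifF; last lia.
  by rewrite E4 E3 !updN //; lia.
have low j : (6 <= j < K)%N -> j != 6%N -> j != 10%N -> m6 j = 0.
  by move=> Kj j6 j10; rewrite E6 !updN; try lia; rewrite E5 ifT //; lia.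
split.
- by rewrite E6.
- by rewrite E6.
- by rewrite E6.
- by rewrite E6 !updN // E5 /= E4.
- by rewrite E6 updE KE.
- move=> x xV; rewrite /rn /= /fset.
  case: eqP => [->|x1]; first by rewrite E6.
  case: eqP => [->|x0]; first by rewrite E6.
  by rewrite low //; lia.
- by move=> x xV; rewrite /rr low //=; lia.
- by move=> x xV; rewrite /rd low //=; lia.
- move=> a i; rewrite far; last lia.
  rewrite E2 so; [|lia|].
    by rewrite init_mem_far //; lia.
  by case: a => i' ?; lia.
- move=> a i /=; rewrite far; last lia.
  rewrite E2; case: a => /=.
    rewrite so; [|lia|by move=> i' ?; lia].
    by rewrite init_mem_far //; lia.
  rewrite addn0; case: ltnP => iK; first by rewrite sB //; lia.
  rewrite so; [|lia|by move=> i' ?; lia].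
  by rewrite init_mem_far //; lia.
- move=> i iN /=; rewrite -KE far ?leq_addr // E2 so; [by []|lia|].
  by move=> i' ?; lia.
Qed.

(** The registers are overwritten from cell 2 upwards; at that point only the pointer in cell 0 and
    the constant 1 in cell 1 are still needed. Cells from [K] on keep what the program left in
    [inp]. *)
Lemma epilogue_correct s mm : rep V N B s mm ->
  safe epilogue mm /\ forall j, (j < N)%N ->
    exec epilogue mm (2 + j)%N =
    if (2 + j < K)%N then (na s true j)%:R : R else inp s (2 + j - K)%N.
Proof.
move=> r; have KB := far_base.
rewrite /epilogue; pose l := [:: IAdd 0 0 3] ++ nseq 3 (IAdd 0 0 1).
have -> : [:: IAdd 0 0 3] ++ nseq 3 (IAdd 0 0 1) ++ restore_registers = l ++ restore_registers by [].
have E : exec l mm = upd mm 0 (B + 3)%:R.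
  rewrite /= !upd_upd !updE !updN // (rep0 r) (rep1 r) (repB r); apply: eq_upd.
  by rewrite natrD; ring.
have S : safe l mm by [].
rewrite exec_cat E.
set m1 := upd _ _ _ in E *.
have no j : (K <= j)%N -> m1 j = mm j by move=> Kj; rewrite /m1 updN //; lia.
suff loop j k m2 : m2 0%N = (B + 4 * (k - 2) + 3)%:R -> m2 1%N = 1 -> (1 < k)%N -> (k + j = K)%N ->
  (forall x, (2 + x < k)%N -> m2 (2 + x)%N = (na s true x)%:R) ->
  (forall x, (K <= x)%N -> m2 x = mm x) ->
  let l := flatten [seq ILoad k 0 :: nseq 4 (IAdd 0 0 1) | k <- iota k j] in
  [/\ safe l m2, (forall x, (2 + x < K)%N -> exec l m2 (2 + x)%N = (na s true x)%:R) &
  forall x, (K <= x)%N -> exec l m2 x = mm x].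
  have [|||||sf lo hi] := loop (K - 2)%N 2%N m1 _ _ _ _ _ no.
  - by rewrite /m1 updE subnn muln0 addn0.
  - by rewrite /m1 updN // (rep1 r).
  - by [].
  - by lia.
  - by [].
  split; first by apply/safe_cat; split=> //; rewrite E.
  move=> j jN; case: ltnP => jK; first by rewrite lo.
  rewrite hi // -(repi r); first by congr mm; rewrite -KE; lia.
  by lia.
elim: j k m2 => [|j IH] k m2 h0 h1 k1 kj lo hi.
  by split=> //= x xK; apply: lo; lia.
cbv zeta; set l0 := flatten _.
have -> : l0 = (ILoad k 0 :: nseq 4 (IAdd 0 0 1)) ++
   flatten [seq ILoad k1 0 :: nseq 4 (IAdd 0 0 1) | k1 <- iota k.+1 j] by [].
move: (flatten _) (IH k.+1) => {l0} l' {}IH.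
pose m3 := upd (upd m2 k (na s true (k - 2))%:R) 0 (B + 4 * (k.+1 - 2) + 3)%:R.
have E3 : exec (ILoad k 0 :: nseq 4 (IAdd 0 0 1)) m2 = m3.
  rewrite -cat1s exec_cat exec_addn //= h0 natrK.
  (* The 3 is the offset of the natural array [true], the boolean counting as 1. *)
  rewrite (_ : B + 4 * (k - 2) + 3 = B + 4 * (k - 2) + (2 + true))%N //.
  rewrite hi ?(repna r) /m3; last lia.
  rewrite !updN; try lia; rewrite h0 h1; apply: eq_upd.
  rewrite (_ : (B + 4 * (k.+1 - 2) + 3 = B + 4 * (k - 2) + 3 + 4)%N); last lia.
  by rewrite (natrD _ _ 4); ring.
have S3 : safe (ILoad k 0 :: nseq 4 (IAdd 0 0 1)) m2.
  by split; [eexists; exact: h0|exact: safe_nseq].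
have [||||||sf lo' hi'] := IH m3.
- by rewrite /m3 updE.
- by rewrite /m3 !updN //; lia.
- by lia.
- by lia.
- move=> x xk; rewrite /m3 updN //.
  case: (eqVneq (2 + x)%N k) => [<-|ne]; last by rewrite updN ?lo //; lia.
  by rewrite updE; congr (na s true _)%:R; lia.
- by move=> x xK; rewrite /m3 !updN ?hi //; lia.
split; first by apply: (proj2 (safe_cat _ _ _)); split; rewrite ?E3.
- by move=> x; rewrite exec_cat E3; exact: lo'.
- by move=> x; rewrite exec_cat E3; exact: hi'.
Qed.

Lemma whole_runs c : fits V 0 c ->
  let s := run N c input_state in
  exists k mm, [/\ (k <= size prologue + time N c + size epilogue)%N,
    steps (whole c) k (Config 0 m0) mm, halted (whole c) mm &
    forall j, (j < N)%N -> mem mm (2 + j)%N =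
      if (2 + j < K)%N then (na s true j)%:R : R else inp s (2 + j - K)%N].
Proof.
move=> fc s; have [sp rp] := prologue_correct.
have KNB : (6 + 4 * V + N <= B)%N by rewrite -KE; exact: far_base.
have [k [m' [kT st r' _]]] :=
  @compile_simulates R V N B KNB c (size prologue) 0 input_state fc (leq0n V)
    prologue (epilogue ++ [:: IHalt]) _ erefl rp.
have [se He] := epilogue_correct r'.
exists (size prologue + (k + size epilogue))%N.
exists (Config (size prologue + size (compile (size prologue) 0 c) + size epilogue)
  (exec epilogue m')); split=> //.
- by lia.
- apply: steps_trans.
    exact: (@steps_exec R [::] prologue (compile (size prologue) 0 c ++ epilogue ++ [:: IHalt])).
  apply: steps_trans; first exact: st.
  have := @steps_exec R (prologue ++ compile (size prologue) 0 c) epilogue [:: IHalt] _ se.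
  by rewrite size_cat -catA.
- rewrite /whole; move: (compile _ _ _) => C; move: prologue epilogue => P E.
  split=> /=; first by rewrite !size_cat /=; lia.
  by rewrite 2!catA nth_cat !size_cat ltnn subnn.
Qed.

End Run.
End WholeProgram.

(** * From sums of ratios to products, and list scheduling *)

Section Analytic.
Variable R : realType.

(** AM-GM for the ratios [x i / y i], whose mean is at most [c]. *)
Lemma prod_le_of_sum_ratio n (x y : 'I_n -> R) c :
  (forall i, 0 <= x i) -> (forall i, 0 < y i) ->
  \sum_i x i / y i <= n%:R * c -> \prod_i x i <= c ^+ n * \prod_i y i.
Proof.
move=> x0 y0 H.
have [n0|n0] := posnP n.
  by move: x y x0 y0 H; rewrite n0 => *; rewrite !big_ord0 expr0 mulr1.
have := @leif_AGM R 'I_n predT (fun i => x i / y i).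
rewrite cardT size_enum_ord => /(_ _) [|le _].
  by move=> i _; rewrite divr_ge0 // ltW.
have {}le : \prod_(i < n) (x i / y i) <= c ^+ n.
  apply: (le_trans le); rewrite lerXn2r ?nnegrE //.
  - by rewrite divr_ge0 // sumr_ge0 // => i _; rewrite divr_ge0 // ltW.
  - have n1 : 0 < n%:R :> R by rewrite ltr0n.
    rewrite -(pmulr_rge0 c n1).
    apply: le_trans H; rewrite sumr_ge0 // => i _; by rewrite divr_ge0 // ltW.
  - by rewrite ler_pdivrMr ?ltr0n // mulrC.
have P : 0 < \prod_(i < n) y i by apply: prodr_gt0.
by rewrite -ler_pdivrMr //; move: le; rewrite big_split prodfV.
Qed.

(** [O] are the optimal loads and [F] the greedy ones; [B] is the big part of [F], [s] and [t] are
    the small parts of [O] and [F], and [d] bounds both the loss on big items and the greedy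
    imbalance. Let [h] be the least load in [F]. Small items lie only on agents with loads between
    [h] and [h + d], so the ratios sum to at most [n * (1 + d / h)] plus the total small weight
    times [1 / h - 1 / (h + d)]. *)
Lemma list_scheduling_bound n (O F B s t : 'I_n -> R) (l d : R) :
  0 < l -> 0 <= d -> 4 * d <= l ->
  (forall i, l <= O i) -> (forall i, O i <= B i + d + s i) ->
  (forall i, F i = B i + t i) -> (forall i, 0 <= t i) ->
  (forall i, 0 <= s i <= 2 * l) -> \sum_i t i = \sum_i s i ->
  (forall i k, 0 < t i -> F i <= F k + d) ->
  \prod_i O i <= (1 + 10 * (d / l)) ^+ n * \prod_i F i.
Proof.
move=> l0 d0 dl lO OB FE t0 s0 ts FF.
have [n0|n0] := posnP n.
  by subst n; rewrite !big_ord0 expr0 mulr1.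
have [k0 k0P] : exists k0, forall i, F k0 <= F i.
  have := @arg_minP _ R 'I_n (Ordinal n0) predT F isT.
  by case=> k _ H; exists k => i; apply: H.
set h := F k0 in k0P.
have hl : l - 2 * d <= h.
  have [[i ti] | no] := pselect (exists i, 0 < t i).
    (* The small totals agree, so some agent with small items has at least as much of them as in the
       optimum. Its load is at least [l - d], and [h] is within [d] of it. *)
    have [j [tj sj]] : exists j, 0 < t j /\ s j <= t j.
      apply: contrapT => H.
      have lt j : 0 < t j -> t j < s j.
        by move=> tj; rewrite ltNge; apply/negP => sj; apply: H; exists j.
      have ge j : 0 <= s j - t j.
        have [->|tn] := eqVneq (t j) 0; first by rewrite subr0; case/andP: (s0 j).
        by rewrite subr_ge0 ltW // lt // lt_def tn t0.
      have /eqP : \sum_j (s j - t j) = 0 by rewrite sumrB ts subrr.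
      rewrite psumr_eq0 // => /allP /(_ i (mem_index_enum _)) /=.
      by rewrite subr_eq0 gt_eqF // lt.
    have := FF j k0 tj; have := OB j; have := lO j; rewrite -/h FE; lra.
  (* Without small items, [F k0] is its big part alone, which is within [d] of [O k0]. *)
  have tz i : t i = 0.
    by apply/eqP; rewrite eq_le t0 andbT leNgt; apply/negP => H; apply: no; exists i.
  have /eqP : \sum_i s i = 0 by rewrite -ts big1.
  rewrite psumr_eq0; last by move=> i _; case/andP: (s0 i).
  move=> /allP /(_ k0 (mem_index_enum _)) /= /eqP sk.
  have := OB k0; have := lO k0; rewrite /h FE tz sk; lra.
have hl2 : l / 2 <= h by lra.
have h0 : 0 < h by lra.
have F0 i : 0 < F i by apply: lt_le_trans (k0P i).
apply: prod_le_of_sum_ratio => // [i|].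
  by apply: le_trans (lO i); exact: ltW.
have step i : O i / F i <= 1 + d / h + s i / h - t i / (h + d).
  have [si si2] := andP (s0 i).
  have h1 : O i / F i <= 1 + d / F i + s i / F i - t i / F i.
    have -> : 1 + d / F i + s i / F i - t i / F i = (F i + d + s i - t i) / F i.
      by rewrite !mulrDl mulNr divff ?gt_eqF.
    by rewrite ler_pM2r ?invr_gt0 // FE; have := OB i; lra.
  apply: (le_trans h1).
  have Fh : (F i)^-1 <= h^-1 by rewrite lef_pV2 ?posrE.
  have h2 : d / F i <= d / h by apply: ler_wpM2l.
  have h3 : s i / F i <= s i / h by apply: ler_wpM2l.
  have h4 : t i / (h + d) <= t i / F i.
    have [->|tn] := eqVneq (t i) 0; first by rewrite !mul0r.
    have tp : 0 < t i by rewrite lt_def tn t0.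
    apply: ler_wpM2l => //; rewrite lef_pV2 ?posrE //; first exact: FF.
    by lra.
  by lra.
apply: (le_trans (ler_sum _ (fun i _ => step i))).
rewrite !big_split /= sumrN -!mulr_suml ts !sumr_const card_ord.
set S := \sum_(i < n) s i.
have S2 : S <= n%:R * (2 * l).
  rewrite mulr_natl -[n in _ *+ n]card_ord -sumr_const; apply: ler_sum => i _.
  by case/andP: (s0 i).
have S0 : 0 <= S by apply: sumr_ge0 => i _; case/andP: (s0 i).
have hd : 0 < h + d by lra.
(* Here [S] is at most [2 * n * l], and both [h] and [h + d] are at least [l / 2]. This gives 8 of
   the 10; the term [d / h] gives the other 2. *)
have e1 : S / h - S / (h + d) <= n%:R * (8 * (d / l)).
  have -> : S / h - S / (h + d) = S * (d / (h * (h + d))).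
    by field; rewrite !gt_eqF.
  have e2 : d / (h * (h + d)) <= d * (4 / l ^+ 2).
    apply: ler_wpM2l => //.
    have -> : 4 / l ^+ 2 = (l / 2 * (l / 2))^-1 by field; rewrite gt_eqF.
    rewrite lef_pV2 ?posrE ?mulr_gt0 //; try lra.
    by apply: ler_pM; lra.
  apply: (@le_trans _ _ (n%:R * (2 * l) * (d * (4 / l ^+ 2)))).
    by apply: ler_pM => //; rewrite divr_ge0 // mulr_ge0 // ltW.
  by rewrite le_eqVlt; apply/orP; left; apply/eqP; field; rewrite gt_eqF.
have e3 : d / h *+ n <= n%:R * (2 * (d / l)).
  rewrite -mulr_natl; apply: ler_wpM2l; first exact: ler0n.
  have -> : 2 * (d / l) = d * (l / 2)^-1 by field; rewrite gt_eqF.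
  by apply: ler_wpM2l => //; rewrite lef_pV2 ?posrE //; lra.
have -> : n%:R * (1 + 10 * (d / l)) = n%:R + n%:R * (2 * (d / l)) + n%:R * (8 * (d / l)) by ring.
by lra.
Qed.

End Analytic.

Lemma eq_class_counts_sum (R : realType) (I : finType) (P Q : pred I) k (c : I -> 'I_k) (g : 'I_k -> R) :
  (forall x, #|[pred i | P i & c i == x]| = #|[pred i | Q i & c i == x]|) ->
  \sum_(i | P i) g (c i) = \sum_(i | Q i) g (c i).
Proof.
move=> H; have aux (P' : pred I) :
    \sum_(i | P' i) g (c i) = \sum_x g x *+ #|[pred i | P' i & c i == x]|.
  rewrite (partition_big c predT) //=; apply: eq_bigr => x _.
  rewrite -sumr_const; apply: eq_big => // i /andP[_ /eqP -> //].
by rewrite !aux; apply: eq_bigr => x _; rewrite H.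
Qed.

(** * Rounding weights to levels *)

Section Levels.
Variables (R : realType) (l : R) (q : nat).
Hypotheses (l0 : 0 < l) (q0 : (7 < q)%N).

(** Level 0 is for small items and [(q ^ 2).+1] for huge ones. A weight strictly between never gets
    level 0, since [l / q] is at least one step [l / q ^ 2]. *)
Definition level (x : R) : nat :=
  if x <= l / q%:R then 0
  else if l < x then (q ^ 2).+1 else Num.truncn (x / (l / q%:R ^+ 2)).

Lemma level_q_gt0 : 0 < q%:R :> R. Proof. by rewrite ltr0n; exact: leq_trans q0. Qed.
Let q1 := level_q_gt0.
Lemma level_step_gt0 : 0 < l / q%:R ^+ 2. Proof. by rewrite divr_gt0 // exprn_gt0. Qed.
Let d0 := level_step_gt0.
Lemma level_cutoff_gt0 : 0 < l / q%:R. Proof. by rewrite divr_gt0. Qed.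
Let e0 := level_cutoff_gt0.

Lemma level_step_le : l / q%:R ^+ 2 <= l / q%:R.
Proof.
rewrite ler_pM2l // lef_pV2 ?posrE ?exprn_gt0 // -natrX ler_nat -mulnn leq_pmulr //.
by apply: leq_trans q0.
Qed.
Let de := level_step_le.

Lemma level_trunc x : l / q%:R < x <= l ->
  [/\ (0 < level x <= q ^ 2)%N, (level x)%:R * (l / q%:R ^+ 2) <= x
    & x <= (level x).+1%:R * (l / q%:R ^+ 2)].
Proof.
case/andP=> ex xl; rewrite /level leNgt ex /= ltNge xl /=.
have x0 : 0 <= x by have := e0; lra.
have y0 : 0 <= x / (l / q%:R ^+ 2) by rewrite divr_ge0 // ltW.
have [h1 h2] := andP (Num.Theory.truncn_itv y0).
split.
- rewrite truncn_gt0 -ltnS -(ltr_nat R) -natr1; apply/andP; split.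
    by rewrite ler_pdivlMr // mul1r; apply: le_trans (ltW ex).
  apply: (le_lt_trans h1); rewrite ltr_pdivrMr // natrX.
  have -> : (q%:R ^+ 2 + 1) * (l / q%:R ^+ 2) = l + l / q%:R ^+ 2.
    by field; rewrite gt_eqF.
  by have := d0; lra.
- by rewrite -ler_pdivlMr.
- by rewrite -ler_pdivrMr // ltW.
Qed.

Lemma level0 x : (level x == 0)%N = (x <= l / q%:R).
Proof.
have [h|h] := leP x (l / q%:R); first by rewrite /level h.
have [xl|lx] := leP x l; last by rewrite /level leNgt h /= lx.
have [|/andP[]] := @level_trunc x; first by rewrite h xl.
by lia.
Qed.

Lemma level_cutoff_le : l / q%:R <= l.
Proof. by rewrite ler_pdivrMr // ler_peMr ?(ltW l0) // ler1n; apply: leq_trans q0. Qed.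
Let el := level_cutoff_le.

Lemma level_huge x : (level x == (q ^ 2).+1)%N = (l < x).
Proof.
have [lx|xl] := ltP l x.
  by rewrite /level leNgt (le_lt_trans el lx) /= lx eqxx.
have [h|h] := leP x (l / q%:R); first by rewrite /level h.
have [|/andP[_ h1] _ _] := @level_trunc x; first by rewrite h xl.
by apply/eqP; lia.
Qed.

Lemma level_le x : (level x < (q ^ 2).+2)%N.
Proof.
have [lx|xl] := ltP l x.
  by rewrite ltnS; have := level_huge x; rewrite lx => /eqP ->.
have [h|h] := leP x (l / q%:R); first by rewrite /level h.
have [|/andP[_ h1] _ _] := @level_trunc x; first by rewrite h xl.
by lia.
Qed.

Lemma level_mono x y : x <= y -> (level x <= level y)%N.
Proof.
move=> xy.
have [ly|yl] := ltP l y.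
  by have := level_huge y; rewrite ly => /eqP ->; rewrite -ltnS level_le.
have [h|h] := leP x (l / q%:R); first by rewrite /level h.
rewrite /level !leNgt h (lt_le_trans h xy) /= !ltNge yl (le_trans xy yl) /=.
by apply: le_truncn; rewrite ler_pM2r ?invr_gt0.
Qed.

End Levels.

(** * Structure of an optimal allocation, and comparison with a greedy one *)

Section Optimum.
Variables (R : realType) (n m : nat) (w : nat -> R).
Hypothesis w0 : nonneg_on m w.
Local Notation bw := (bundle_w m w).

Lemma bundle_ge0 X i : 0 <= bw X i.
Proof. by apply: sumr_ge0 => j _; apply: w0. Qed.

Lemma bundle_move (X : nat -> nat) (j : 'I_m) k i : X j != k ->
  bw (fset X (j : nat) k) i = if i == k then bw X i + w j
                      else if i == X j then bw X i - w j else bw X i.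
Proof.
move=> Xk; rewrite /bundle_w !(big_mkcond (fun x : 'I_m => _ == _)).
rewrite !(bigD1 (P := predT) j) //= fsetE eq_sym.
rewrite (eq_bigr (fun x : 'I_m => if X x == i then w x else 0)); last first.
  by move=> x xj; rewrite fsetN.
rewrite (eq_sym (X j)); case: eqP => [->|ik].
  by rewrite (eq_sym k) (negbTE Xk); ring.
by case: eqP => _; ring.
Qed.

Variable O : nat -> nat.
Hypothesis Opart : is_partition n m O.
Hypothesis Oopt : forall S, is_partition n m S ->
  \prod_(i < n) bw S i <= \prod_(i < n) bw O i.
Hypothesis Opos : 0 < \prod_(i < n) bw O i.

Lemma opt_bundle_gt0 (i : 'I_n) : 0 < bw O i.
Proof.
rewrite lt_def bundle_ge0 andbT; apply/negP => /eqP E.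
by move: Opos; rewrite (bigD1 i) //= E mul0r ltxx.
Qed.

(** Giving [j] to [k] turns two factors [x * y] of the product into [(x - w j) * (y + w j)]. The
    other factors are positive, so optimality yields [w j * (x - w j - y) <= 0]. *)
Lemma opt_local (j : 'I_m) (k : 'I_n) : 0 < w j -> bw O (O j) - w j <= bw O k.
Proof.
move=> wj; pose i := Ordinal (Opart (ltn_ord j)).
have [E|Ne] := eqVneq (O j) k; first by rewrite E gerBl ltW.
have ik : k != i by apply: contra Ne => /eqP ->.
have part : is_partition n m (fset O (j : nat) k).
  by move=> x xm; rewrite /fset; case: eqP => // _; exact: Opart.
have := Oopt part; rewrite !(bigD1 i (P := predT)) //= !(bigD1 k (P := fun x => x != i)) //=.
rewrite !bundle_move // !eqxx (_ : (O j == k) = false); last exact: negbTE.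
rewrite (eq_bigr (fun x : 'I_n => bw O x)); last first.
  move=> x /andP[xi xk]; rewrite bundle_move // -[(x : nat) == k]/(x == k) (negbTE xk).
  by rewrite -[(x : nat) == _]/(x == i) (negbTE xi).
set r := \prod_(x < n | _) _.
have r0 : 0 < r by apply: prodr_gt0 => x _; exact: opt_bundle_gt0.
rewrite !mulrA ler_pM2r // => H.
have : w j * (bw O (O j) - w j - bw O k) <= 0 by lra.
by rewrite pmulr_rle0 // subr_le0.
Qed.

Variables (l : R) (q : nat).
Hypothesis q0 : (7 < q)%N.
Hypothesis lmin : forall i : 'I_n, l <= bw O i.
Hypothesis latt : exists i : 'I_n, bw O i = l.

Let l0 : 0 < l.
Proof. by case: latt => i <-; exact: opt_bundle_gt0. Qed.

Lemma opt_minus_item (j : 'I_m) : 0 < w j -> bw O (O j) <= l + w j.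
Proof. by case: latt => k <- wj; have := opt_local k wj; lra. Qed.

Lemma two_items_le_bundle (X : nat -> nat) (j k : 'I_m) : j != k -> X k = X j -> w j + w k <= bw X (X j).
Proof.
move=> jk E; rewrite /bundle_w (bigD1 j) //= (bigD1 k) /=; last by rewrite E eqxx eq_sym.
by rewrite addrA lerDl sumr_ge0 // => x _; exact: w0.
Qed.

(* Otherwise moving the other item to a least loaded machine would increase the product. *)
Lemma huge_item_alone (j k : 'I_m) : l < w j -> O k = O j -> k != j -> w k = 0.
Proof.
move=> wj E kj; apply/eqP; rewrite eq_le w0 // andbT leNgt; apply/negP => wk.
have := opt_minus_item wk; have := @two_items_le_bundle O j k; rewrite eq_sym E => /(_ kj erefl).
lra.
Qed.

Local Notation level := (level l q).
Let q1 := @level_q_gt0 R q q0.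
Let d0 := @level_step_gt0 R l q l0 q0.
Let e0 := @level_cutoff_gt0 R l q l0 q0.
Let de := @level_step_le R l q l0 q0.
Let el := @level_cutoff_le R l q l0 q0.
Let level_trunc := @level_trunc R l q l0 q0.
Let level0 := @level0 R l q l0 q0.
Let level_huge := @level_huge R l q l0 q0.
Let level_le := @level_le R l q l0 q0.

Definition level_count (X : nat -> nat) (i k : nat) : nat :=
  #|[pred j : 'I_m | (X j == i) && (level (w j) == k)]|.

(** Without one item of the level the bundle weighs at most [l], and each further item of the level
    weighs more than [l / q]: there are at most [q] of them. *)
Lemma level_count_le (i : 'I_n) k : (0 < k)%N -> (level_count O i k <= q.+1)%N.
Proof.
move=> k0; rewrite /level_count.
set P := [pred j : 'I_m | _].
have [E|/card_gt0P [j Pj]] := posnP #|P|; first by rewrite E.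
have /andP[/eqP Oj /eqP cj] := Pj.
have big x : P x -> l / q%:R < w x.
  by move=> /andP[_ /eqP cx]; rewrite ltNge -level0 cx -lt0n.
have wj : 0 < w j by apply: lt_trans e0 (big _ Pj).
rewrite (cardD1x Pj) ltnS -(ler_nat R).
have := opt_minus_item wj; rewrite Oj /bundle_w (bigD1 j) /=; last by rewrite Oj.
rewrite addrC lerD2r => H.
have : \sum_(x | [predD1 P & j] x) l / q%:R <= l.
  apply: le_trans H; rewrite [leRHS](bigID (fun x : 'I_m => level (w x) == k)) /=.
  rewrite -[leLHS]addr0 lerD //; last by apply: sumr_ge0 => x _; exact: w0.
  rewrite [leLHS](eq_bigl (fun x : 'I_m => (O x == i) && (x != j) && (level (w x) == k))).
    by apply: ler_sum => x /andP[/andP[a _] c]; apply/ltW/big; rewrite /P /= a.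
  by move=> x; rewrite /= andbA (andbC (x != j)) -!andbA.
rewrite sumr_const -[_ *+ _]mulr_natl mulrA ler_pdivrMr // mulrC ler_pM2l // => H'.
by apply: le_trans H'; rewrite ler_nat; apply: eq_leq; apply: eq_card => x; rewrite !inE andbC.
Qed.

Variable A : nat -> nat.
Hypothesis Apart : is_partition n m A.
Hypothesis AO : forall (i : 'I_n) k, (0 < k)%N -> level_count A i k = level_count O i k.
Hypothesis Agreedy : forall (j : 'I_m) (k : 'I_n), level (w j) = 0%N ->
  bw A (A j) <= bw A k + l / q%:R.

(** The factor [H A i / H O i] exchanges the huge item that agent [i] has in [O] for the one it has
    in [A]; by [prod_huge] these factors cancel over all agents. *)
Let H (X : nat -> nat) i : R := \prod_(j < m | (X j == i) && (level (w j) == (q ^ 2).+1)) w j.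

Lemma prod_huge X : is_partition n m X ->
  \prod_(i < n) H X i = \prod_(j < m | level (w j) == (q ^ 2).+1) w j.
Proof.
move=> Xp; pose f (j : 'I_m) : 'I_n := Ordinal (Xp _ (ltn_ord j)).
rewrite [RHS](partition_big f predT) //=; apply: eq_bigr => i _.
by apply: eq_bigl => j; rewrite andbC.
Qed.

Lemma huge_gt0 (X : nat -> nat) i : 0 < H X i.
Proof.
by apply: prodr_gt0 => j /andP[_]; rewrite level_huge; apply: lt_trans.
Qed.

Lemma level_sum (i : 'I_n) (g : nat -> R) :
  \sum_(j < m | (O j == i) && (level (w j) != 0%N)) g (level (w j)) =
  \sum_(j < m | (A j == i) && (level (w j) != 0%N)) g (level (w j)).
Proof.
pose c (j : 'I_m) : 'I_(q ^ 2).+2 := Ordinal (level_le (w j)).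
apply: (@eq_class_counts_sum _ _ _ _ _ c (fun k => g k)) => k.
have [k0|k0] := posnP k.
  have z (X : nat -> nat) : #|[pred j : 'I_m | (X j == i) && (level (w j) != 0%N) & c j == k]| = 0%N.
    apply: eq_card0 => j; rewrite !inE -[c j == k]/(level (w j) == k) k0.
    by case: (level _ == 0%N); rewrite ?andbF.
  by rewrite !z.
have z (X : nat -> nat) : #|[pred j : 'I_m | (X j == i) && (level (w j) != 0%N) & c j == k]| =
    level_count X i k.
  apply: eq_card => j; rewrite !inE -[c j == k]/(level (w j) == k) -andbA; congr andb.
  by case: (eqVneq (level (w j)) k) => [->|_]; rewrite ?andbF // andbT; lia.
by rewrite !z AO.
Qed.

(** The rounding loss of a bundle, one step per big item: all but one of them weigh at most [l]
    together, hence cost at most [l / q] in steps, and the last one costs one step more. *)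
Lemma many_big_items (i : 'I_n) : (forall j : 'I_m, O j = i -> w j <= l) ->
  \sum_(j < m | (O j == i) && (level (w j) != 0%N)) (l / q%:R ^+ 2) <= 2 * (l / q%:R).
Proof.
move=> small.
set P := fun j : 'I_m => (O j == i) && (level (w j) != 0%N).
have big x : P x -> l / q%:R < w x.
  by move=> /andP[_ cx]; rewrite ltNge -level0.
have [j Pj|no] := pickP P; last by rewrite big_pred0 //; have := e0; lra.
have [/eqP Oj _] := andP Pj.
have wj : 0 < w j by apply: lt_trans e0 (big _ Pj).
have := opt_minus_item wj; rewrite Oj /bundle_w (bigD1 j) /=; last by rewrite Oj.
rewrite addrC lerD2r => H1.
have : \sum_(x | P x && (x != j)) l / q%:R <= l.
  apply: le_trans H1; rewrite [leRHS](bigID (fun x : 'I_m => level (w x) != 0%N)) /=.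
  rewrite -[leLHS]addr0 lerD //; last by apply: sumr_ge0 => x _; exact: w0.
  rewrite [leLHS](eq_bigl (fun x : 'I_m => (O x == i) && (x != j) && (level (w x) != 0%N))).
    by apply: ler_sum => x /andP[/andP[a _] c]; apply/ltW/big; rewrite /P /= a.
  by move=> x; rewrite /P -!andbA (andbC (x != j)).
have E : \sum_(x | P x && (x != j)) l / q%:R =
  q%:R * \sum_(x | P x && (x != j)) l / q%:R ^+ 2.
  by rewrite mulr_sumr; apply: eq_bigr => x _; field; rewrite gt_eqF.
rewrite E mulrC -ler_pdivlMr // => H2.
rewrite (bigD1 j) //=.
by have := de; lra.
Qed.

(** The loads of [O] are replaced by [O'], where each huge item is exchanged for the one that [A]
    gives to the same agent. The product is unchanged, and the loads become comparable agent by
    agent. List scheduling applies with [d = 2 * (l / q)]; its condition [4 * d <= l] is the reason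
    for [7 < q]. *)
Theorem matched_greedy_near_optimal :
  \prod_(i < n) bw O i <= (1 + 20 / q%:R) ^+ n * \prod_(i < n) bw A i.
Proof.
have l1 := l0; have e1 := e0; have d1 := d0.
pose O' (i : 'I_n) := bw O i * (H A i / H O i).
pose s (i : 'I_n) := \sum_(j < m | (O j == i) && (level (w j) == 0%N)) w j.
pose t (i : 'I_n) := \sum_(j < m | (A j == i) && (level (w j) == 0%N)) w j.
pose B (i : 'I_n) := \sum_(j < m | (A j == i) && (level (w j) != 0%N)) w j.
have t0 (i : 'I_n) : 0 <= t i by apply: sumr_ge0 => j _; exact: w0.
have sge (i : 'I_n) : 0 <= s i by apply: sumr_ge0 => j _; exact: w0.
have Bge (i : 'I_n) : 0 <= B i by apply: sumr_ge0 => j _; exact: w0.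
have bAE (i : 'I_n) : bw A i = B i + t i.
  by rewrite /bundle_w (bigID (fun j : 'I_m => level (w j) == 0%N)) /= addrC.
have -> : \prod_(i < n) bw O i = \prod_(i < n) O' i.
  rewrite /O' big_split /= big_split /= prodfV !prod_huge //.
  rewrite divff ?mulr1 // gt_eqF // -(prod_huge Opart).
  by apply: prodr_gt0 => i _; exact: huge_gt0.
have -> : 20 / q%:R = 10 * (2 * (l / q%:R) / l) by field; rewrite !gt_eqF.
have key (i : 'I_n) : [/\ l <= O' i, O' i <= B i + 2 * (l / q%:R) + s i & s i <= 2 * l].
  (* With a huge item in the bundle, the other items have weight 0; then [s i] is 0 and [O' i] is
     the weight of the huge item of [i] in [A]. *)
  have [j /andP[/eqP Oj wj]|no] := pickP (fun j : 'I_m => (O j == i) && (l < w j)).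
    have alone (k : 'I_m) : O k = i -> k != j -> w k = 0.
      by move=> Ok; apply: huge_item_alone => //; rewrite Oj.
    have HO : H O i = w j.
      rewrite /H (bigD1 j) /=; last by rewrite Oj eqxx level_huge.
      rewrite big_pred0 ?mulr1 // => k; apply/negP => /andP[/andP[/eqP Ok]].
      rewrite level_huge => wk kj; move: (alone k Ok kj) wk => ->.
      by rewrite ltNge ltW.
    have bO : bw O i = w j.
      rewrite /bundle_w (bigD1 j) /=; last by rewrite Oj.
      by rewrite big1 ?addr0 // => k /andP[/eqP Ok kj]; exact: alone.
    have sz : s i = 0.
      rewrite /s big1 // => k /andP[/eqP Ok ck]; apply: alone => //.
      apply/eqP => kj; move: ck; rewrite kj level0 => h.
      by have := lt_le_trans wj (le_trans h el); rewrite ltxx.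
    have : level_count A i (q ^ 2).+1 = 1%N.
      rewrite AO // /level_count (eq_card (B := pred1 j)) ?card1 // => k.
      rewrite !inE level_huge; apply/andP/eqP => [[/eqP Ok wk]|->]; last by rewrite Oj.
      apply/eqP; apply: contraLR (wk) => kj; rewrite (alone k Ok kj).
      by rewrite ltNge ltW.
    move=> /mem_card1 [j' Hj'']; 
    have Hj' (k : 'I_m) : (A k == i) && (level (w k) == (q ^ 2).+1) = (k == j') := Hj'' k.
    have /andP[/eqP Aj'] : (A j' == i) && (level (w j') == (q ^ 2).+1) by rewrite Hj' eqxx.
    rewrite level_huge => wj'.
    have HA : H A i = w j'.
      by rewrite /H (eq_bigl (pred1 j')) ?big_pred1_eq // => k; rewrite Hj'.
    have -> : O' i = w j' by rewrite /O' HA HO bO mulrCA divff ?mulr1 // gt_eqF // (lt_trans l0).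
    rewrite sz; split; [exact: ltW| |by lra].
    rewrite addr0; apply: (@le_trans _ _ (B i)); last by lra.
    rewrite /B (bigD1 j') /=; last by rewrite Aj' eqxx level0 -ltNge (le_lt_trans el).
    by rewrite lerDl sumr_ge0 // => k _; exact: w0.
  have small (j' : 'I_m) : O j' = i -> w j' <= l.
    move=> E; rewrite leNgt; apply/negP => h.
    by have := no j'; rewrite E eqxx h.
  have HO : H O i = 1.
    by rewrite /H big_pred0 // => j; rewrite level_huge; exact: no.
  have HA : H A i = 1.
    rewrite /H big_pred0 // => j; apply/negbTE/negP => Pj.
    have : (0 < level_count A i (q ^ 2).+1)%N by apply/card_gt0P; exists j.
    rewrite AO // => /card_gt0P [k]; rewrite !inE level_huge; by rewrite no.
  have -> : O' i = bw O i by rewrite /O' HO HA divr1 mulr1.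
  have bOE : bw O i = s i + \sum_(j < m | (O j == i) && (level (w j) != 0%N)) w j.
    by rewrite /bundle_w (bigID (fun j : 'I_m => level (w j) == 0%N)).
  split; first exact: lmin.
  (* [g] rounds up and [g'] rounds down. Equal level counts turn the sum rounded up over [O] into
     the sum rounded down over [A] plus one step per item. *)
  - pose g k : R := k.+1%:R * (l / q%:R ^+ 2).
    pose g' k : R := k%:R * (l / q%:R ^+ 2).
    have mid (j : 'I_m) : O j = i -> level (w j) != 0%N -> l / q%:R < w j <= l.
      by move=> Oj cj; rewrite ltNge -level0 cj small.
    have h1 : \sum_(j < m | (O j == i) && (level (w j) != 0%N)) w j <=
              \sum_(j < m | (O j == i) && (level (w j) != 0%N)) g (level (w j)).
      apply: ler_sum => j /andP[/eqP Oj cj].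
      by have [] := level_trunc (mid j Oj cj).
    have midA (j : 'I_m) : A j = i -> level (w j) != 0%N -> l / q%:R < w j <= l.
      move=> Aj cj; rewrite ltNge -level0 cj leNgt -level_huge /=; apply/negP => cj'.
      have : (0 < level_count A i (q ^ 2).+1)%N.
        by apply/card_gt0P; exists j; rewrite !inE Aj eqxx.
      rewrite AO // => /card_gt0P [k]; rewrite !inE level_huge; by rewrite no.
    have h2 : \sum_(j < m | (A j == i) && (level (w j) != 0%N)) g' (level (w j)) <= B i.
      apply: ler_sum => j /andP[/eqP Oj cj].
      by have [] := level_trunc (midA j Oj cj).
    have h3 : \sum_(j < m | (O j == i) && (level (w j) != 0%N)) g (level (w j)) =
      \sum_(j < m | (O j == i) && (level (w j) != 0%N)) g' (level (w j)) +
      \sum_(j < m | (O j == i) && (level (w j) != 0%N)) (l / q%:R ^+ 2).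
      by rewrite -big_split; apply: eq_bigr => j _; rewrite /g /g' -natr1 mulrDl mul1r.
    have h4 := many_big_items small.
    rewrite -level_sum in h2.
    by rewrite bOE; lra.
  - apply: (@le_trans _ _ (bw O i)).
      by rewrite bOE lerDl; apply: sumr_ge0 => j _; exact: w0.
    (* Any item of positive weight bounds the load by [l + w j], and here no item exceeds [l]. *)
    have [j /andP[/eqP Oj wj]|no'] := pickP (fun j : 'I_m => (O j == i) && (0 < w j)).
      by have := opt_minus_item wj; have := small j Oj; rewrite Oj; lra.
    rewrite /bundle_w big1; first by lra.
    move=> j Oj; apply/eqP; rewrite eq_le w0 // andbT leNgt.
    by have := no' j; rewrite Oj /= => ->.
apply: (@list_scheduling_bound _ n O' _ B s t l (2 * (l / q%:R))) => //.
- by lra.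
- rewrite mulrA mulrA ler_pdivrMr // mulrC ler_pM2l //.
  by rewrite -natrM ler_nat; lia.
- by move=> i; have [] := key i.
- by move=> i; have [] := key i.
- by move=> i; rewrite sge /=; have [] := key i.
- have tot X (Xp : is_partition n m X) :
    \sum_(i < n) \sum_(j < m | (X j == i) && (level (w j) == 0%N)) w j =
    \sum_(j < m | level (w j) == 0%N) w j.
    pose f (j : 'I_m) : 'I_n := Ordinal (Xp _ (ltn_ord j)).
    rewrite [RHS](partition_big f predT) //=; apply: eq_bigr => i _.
    by apply: eq_bigl => j; rewrite andbC.
  by rewrite /t /s !tot.
- move=> i k ti.
  have [j /andP[/eqP Aj cj]|no] := pickP (fun j : 'I_m => (A j == i) && (level (w j) == 0%N)).
    by have := Agreedy k (eqP cj); rewrite Aj => h; apply: (le_trans h); lra.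
  by move: ti; rewrite /t big_pred0 ?ltxx.
Qed.

End Optimum.

(** * Executing the rules of a code *)

Section Picks.
Variables (R : realType) (n m : nat) (w : nat -> R).

(* Items [j] with [n <= A j] are unassigned. *)
Definition pick_step (d : nat * R * R) (A A' : nat -> nat) : Prop :=
  let: (i, lo, hi) := d in
  (exists j, [/\ (j < m)%N, (n <= A j)%N, lo <= w j <= hi & A' = fset A j i]) \/
  ((forall j, (j < m)%N -> (n <= A j)%N -> ~ (lo <= w j <= hi)) /\ A' = A).

(** A relation rather than a function: the analysis holds for every choice of items within the
    weight ranges, and the program only has to realize one. *)
Fixpoint picks ds (A A' : nat -> nat) : Prop :=
  if ds is d :: ds' then exists2 A1, pick_step d A A1 & picks ds' A1 A' else A' = A.

Lemma picks_cat ds1 ds2 A1 A2 A3 :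
  picks ds1 A1 A2 -> picks ds2 A2 A3 -> picks (ds1 ++ ds2) A1 A3.
Proof.
elim: ds1 A1 => [|d ds1 IH] A1 /=; first by move=> <-.
by case=> A pA H1 H2; exists A => //; apply: IH.
Qed.

(* Digits [4 r .. 4 r + 3] of a code: first and last agent of the rule, lightest and heaviest item it accepts. *)
Definition rule_demands (N : nat) (dig : nat -> nat) r : seq (nat * R * R) :=
  [seq (i, w (dig (4 * r + 2)%N), w (dig (4 * r + 3)%N))
    | i <- iota 0 N & (i < n)%N && (dig (4 * r)%N <= i <= dig (4 * r + 1)%N)%N].

Definition demands N dig Q := flatten [seq rule_demands N dig r | r <- iota 0 Q].

Variables (l : R) (q : nat).
Local Notation lev j := (level l q (w j)).
Local Notation cnt := (level_count m w l q).

Definition unassigned (A : nat -> nat) k :=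
  #|[pred j : 'I_m | (n <= A j)%N && (lev j == k)]|.

Lemma level_countE X i k : cnt X i k = (\sum_(j < m) ((X j == i) && (lev j == k)))%N.
Proof. by rewrite /level_count -sum1_card big_mkcond. Qed.

Lemma unassignedE X k : unassigned X k = (\sum_(j < m) ((n <= X j)%N && (lev j == k)))%N.
Proof. by rewrite /unassigned -sum1_card big_mkcond. Qed.

Lemma level_count_fset (A : nat -> nat) j i0 i k :
  (j < m)%N -> (n <= A j)%N -> (i0 < n)%N -> (i < n)%N ->
  cnt (fset A j i0) i k = (((i0, lev j) == (i, k)) + cnt A i k)%N.
Proof.
move=> jm Aj i0n ni; pose j0 := Ordinal jm.
rewrite !level_countE !(bigD1 (P := predT) j0) //= fsetE xpair_eqE.
have -> : (A j == i) = false by apply/eqP => E; lia.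
rewrite add0n; congr addn; apply: eq_bigr => x xj; rewrite fsetN //.
Qed.

Lemma unassigned_fset (A : nat -> nat) j i0 k :
  (j < m)%N -> (n <= A j)%N -> (i0 < n)%N ->
  unassigned A k = ((lev j == k) + unassigned (fset A j i0) k)%N.
Proof.
move=> jm Aj i0n; pose j0 := Ordinal jm.
rewrite !unassignedE !(bigD1 (P := predT) j0) //= fsetE Aj (leqNgt n i0) i0n.
by rewrite add0n; congr addn; apply: eq_bigr => x xj; rewrite fsetN.
Qed.

Variables lo hi : nat -> R.
Hypothesis lohi : forall k j, (0 < k)%N -> (j < m)%N ->
  (exists2 j', (j' < m)%N & lev j' = k) ->
  (lo k <= w j <= hi k) = (lev j == k).

(** Invariant: each positive level has as many unassigned items as there are demands left for it. So
    no demand finds its level exhausted, and by [lohi] the item taken has the demanded level; level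
    0 is never touched. *)
Lemma picks_match (D : seq (nat * nat)) A A' :
  (forall d, d \in D -> (d.1 < n)%N && (0 < d.2)%N) ->
  (forall k, (0 < k)%N -> unassigned A k = count (fun d => d.2 == k) D) ->
  picks [seq (d.1, lo d.2, hi d.2) | d <- D] A A' ->
  (forall k, (0 < k)%N -> unassigned A' k = 0%N) /\
  (forall i k, (i < n)%N -> (0 < k)%N -> cnt A' i k = cnt A i k + count_mem (i, k) D)%N /\
  (forall j, (j < m)%N -> (A' j < n)%N -> (A j < n)%N || (0 < lev j)%N).
Proof.
elim: D A => [|[i0 k0] D IH] A HD Hu /=.
  by move=> ->; split=> //; split=> [i k _ _|j _ ->//]; rewrite addn0.
have /andP[/= i0n k00] := HD _ (mem_head _ _).
have [j0] : exists j0 : 'I_m, (n <= A j0)%N && (lev j0 == k0).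
  by have := Hu k0 k00; rewrite /= eqxx /unassigned => E; apply/card_gt0P; rewrite E.
case/andP => Aj0 /eqP lj0.
have ex : exists2 j', (j' < m)%N & lev j' = k0 by exists j0.
case=> A1 [[j [jm Aj Hj ->]]|[no _]] HP; last first.
  by case: (no j0 (ltn_ord j0) Aj0); rewrite lohi // lj0.
rewrite lohi // in Hj; move/eqP: Hj => lj.
have [||u [c g]] := IH _ _ _ HP.
- by move=> d dD; apply: HD; rewrite in_cons dD orbT.
- move=> k k_gt0; have := Hu k k_gt0; rewrite (@unassigned_fset A j i0) //= lj.
  by move/addnI.
split=> //; split=> [i k ni k_gt0|x xm /(g x xm)].
  by rewrite c // level_count_fset // lj [in RHS]addnCA addnA.
by rewrite /fset; case: eqP => [->|//] _; rewrite lj k00 orbT.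
Qed.

End Picks.

(** The product is symmetric in the agents, so an optimum may be relabelled. With the profile as
    key, agents of equal profile become consecutive. *)
Lemma sort_machines (R : realType) (n m : nat) (w : nat -> R) (O : nat -> nat) (key : nat -> nat) :
  is_partition n m O ->
  exists (O' f : nat -> nat),
    [/\ is_partition n m O', (forall p, (p < n)%N -> (f p < n)%N),
     (forall i, (i < n)%N -> exists2 p, (p < n)%N & f p = i),
     (forall p j, (p < n)%N -> (j < m)%N -> (O' j == p) = (O j == f p)) &
     (forall p p', (p <= p' < n)%N -> (key (f p) <= key (f p'))%N) /\
     \prod_(i < n) bundle_w m w O' i = \prod_(i < n) bundle_w m w O i].
Proof.
move=> Op; pose leT x y := (key x <= key y)%N.
have tot : total leT by move=> x y; exact: leq_total.
have tr : transitive leT by move=> x y z; exact: leq_trans.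
pose s := sort leT (iota 0 n).
have pm : perm_eq s (iota 0 n) by rewrite perm_sort.
have us : uniq s by rewrite sort_uniq iota_uniq.
have ss : size s = n by rewrite size_sort size_iota.
have ms i : (i \in s) = (i < n)%N by rewrite (perm_mem pm) mem_iota.
pose O' j := index (O j) s; pose f p := nth 0%N s p.
have OO p j : (p < n)%N -> (j < m)%N -> (O' j == p) = (O j == f p).
  move=> pn jm; apply/eqP/eqP => [<-|E]; first by rewrite /f nth_index // ms Op.
  by rewrite /O' E index_uniq // ss.
exists O', f; split=> //.
- by move=> j jm; rewrite /O' -ss index_mem ms Op.
- by move=> p pn; rewrite -ms mem_nth // ss.
- move=> i ni; exists (index i s); first by rewrite -ss index_mem ms.
  by rewrite /f nth_index // ms.
split.
  move=> p p' /andP[pp' p'n].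
  have := sorted_leq_nth tr (fun x => leqnn _) 0%N (sort_sorted tot (iota 0 n)).
  by apply; rewrite ?inE -/s ?ss //; exact: leq_ltn_trans p'n.
rewrite -(big_mkord predT (bundle_w m w O)) /index_iota subn0.
rewrite -(perm_big _ pm) (big_nth 0%N) ss big_mkord; apply: eq_bigr => p _.
by apply: eq_bigl => j; rewrite OO.
Qed.

(** * A code that reproduces the level counts of an optimum *)

(** A profile counts the items of each level, at most [q.+1] by [level_count_le]. The rule
    [(p, k, t)] gives one item of level [k] to every agent of profile [p], and is in force when
    [t < p k]. *)
Definition profile_type q : finType := {ffun 'I_(q ^ 2).+2 -> 'I_q.+2}.
Definition rule_type q : finType := (profile_type q * 'I_(q ^ 2).+2 * 'I_q.+1)%type.
Definition rules q : nat := #|{: rule_type q}|.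

Lemma sum_ltn Q c : (c <= Q)%N -> (\sum_(t < Q) (t < c) = c)%N.
Proof.
elim: Q c => [|Q IH] c; first by rewrite big_ord0; lia.
rewrite leq_eqVlt big_ord_recr /= => /predU1P[->|cQ].
  rewrite ltnS leqnn (eq_bigr (fun=> 1%N)) => [|t _]; last by rewrite ltnW ?ltnS.
  by rewrite sum_nat_const card_ord muln1 addn1.
by rewrite IH ?ltnNge // -ltnS cQ addn0.
Qed.

Lemma count_snd n (D : seq (nat * nat)) k : (forall d, d \in D -> (d.1 < n)%N) ->
  (count (fun d => d.2 == k) D = \sum_(i < n) count_mem (i : nat, k) D)%N.
Proof.
elim: D => [|d D IH] H /=; first by rewrite big1.
rewrite IH; last by move=> x xD; apply: H; rewrite in_cons xD orbT.
have dn := H d (mem_head _ _); rewrite big_split /=; congr addn.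
rewrite (bigD1 (Ordinal dn)) //= big1 => [|i id].
  by case: d {H} dn => a b dn /=; rewrite xpair_eqE eqxx addn0.
by apply/eqP; rewrite eqb0; apply: contra id => /eqP E; apply/eqP/val_inj; rewrite /= E.
Qed.

Section GoodCode.
Variables (R : realType) (n m : nat) (w : nat -> R).
Hypothesis w0 : nonneg_on m w.
Variables (l : R) (q : nat).
Hypothesis q0 : (7 < q)%N.
Local Notation bw := (bundle_w m w).
Local Notation lev j := (level l q (w j)).
Local Notation cnt := (level_count m w l q).
Variable O : nat -> nat.
Hypothesis Opart : is_partition n m O.
Hypothesis lpos : 0 < l.
Hypothesis Ocnt : forall i k, (i < n)%N -> (0 < k)%N -> (cnt O i k <= q.+1)%N.

Definition profile (X : nat -> nat) (i : nat) : profile_type q :=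
  [ffun k : 'I_(q ^ 2).+2 => inord (cnt X i k)].

Hypothesis Osorted : forall i i', (i <= i' < n)%N ->
  (enum_rank (profile O i) <= enum_rank (profile O i'))%N.
Hypothesis n0 : (0 < n)%N.
Hypothesis m0 : (0 < m)%N.

Lemma first_last (P : pred nat) k : (exists2 x, (x < k)%N & P x) ->
  exists a b, [/\ P a, P b, (b < k)%N & forall x, (x < k)%N -> P x -> (a <= x <= b)%N].
Proof.
case=> x xk Px; pose Q := [pred y | (y < k)%N && P y].
have ex : exists y, Q y by exists x; rewrite /= xk.
have ub y : Q y -> (y <= k)%N by case/andP => /ltnW.
case: (ex_minnP ex) => a /andP[_ Pa] amin.
case: (ex_maxnP ex ub) => b /andP[bk Pb] bmax.
exists a, b; split=> // y yk Py; rewrite amin ?bmax //; by rewrite /= yk.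
Qed.

(** [level] is monotone in the weight, so a lightest and a heaviest item of the level delimit it.
    For a level without items [a] and [b] are arbitrary, hence the existence premise. *)
Lemma level_interval k : (0 < k)%N -> exists a b,
  [/\ (a < m)%N, (b < m)%N & forall j, (j < m)%N ->
  (exists2 j', (j' < m)%N & lev j' = k) -> (w a <= w j <= w b) = (lev j == k)].
Proof.
move=> k0; have [[j' j'm lj']|no] := pselect (exists2 j', (j' < m)%N & lev j' = k); last first.
  by exists 0%N, 0%N; split=> // j _ /no.
have H : lev (Ordinal j'm) == k by rewrite /= lj'.
have [a /= /eqP la amin] := @arg_minP _ R 'I_m (Ordinal j'm) (fun j => lev j == k) w H.
have [b /= /eqP lb bmax] := @arg_maxP _ R 'I_m (Ordinal j'm) (fun j => lev j == k) w H.
exists a, b; split=> // j jm _; apply/andP/eqP => [[h1 h2]|lj].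
  have := level_mono lpos q0 h1; have := level_mono lpos q0 h2; rewrite la lb; lia.
have lj2 : lev (Ordinal jm) == k by rewrite /= lj.
by split; [exact: (amin _ lj2)|exact: (bmax _ lj2)].
Qed.

(** A profile class is an interval of agents and a level an interval of weights, so four indices
    express a rule. The demands for [(i, k)] then number [cnt O i k], and [picks_match] applies to
    any execution. *)
Theorem good_code_exists : exists dig : nat -> nat,
  (forall k, (dig k < n + m)%N) /\
  forall A, picks n m w (demands n w (n + m) dig (rules q)) (fun=> n) A ->
    (forall j, (j < m)%N -> (n <= A j)%N = (lev j == 0%N)) /\
    forall (i : 'I_n) k, (0 < k)%N -> cnt A i k = cnt O i k.
Proof.
have /choice [la /choice [ua lu]] : forall k, exists a b, (0 < k)%N ->
  [/\ (a < m)%N, (b < m)%N & forall j, (j < m)%N ->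
  (exists2 j', (j' < m)%N & lev j' = k) -> (w a <= w j <= w b) = (lev j == k)].
  move=> k; have [->|k0] := posnP k; first by exists 0%N, 0%N.
  by have [a [b H]] := level_interval k0; exists a, b.
have /choice [fa /choice [fb fab]] : forall p : profile_type q, exists a b,
  (exists2 i, (i < n)%N & profile O i == p) ->
  (b < n)%N /\ forall i, (i < n)%N -> (profile O i == p) = (a <= i <= b)%N.
  move=> p; have [H|no] := pselect (exists2 i, (i < n)%N & profile O i == p); last first.
    by exists 0%N, 0%N => /no.
  have [a [b [/eqP Pa /eqP Pb bn ab]]] := first_last H.
  exists a, b => _; split=> // i ni; apply/eqP/idP => [E|/andP[ai ib]].
    by apply: ab => //; rewrite E.
  (* The rank of the profile of [i] is squeezed between those of [a] and [b], which coincide. *)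
  have h1 : (a <= i < n)%N by rewrite ai.
  have h2 : (i <= b < n)%N by rewrite ib.
  apply: enum_rank_inj; apply/val_inj/eqP; rewrite eqn_leq.
  by rewrite -{1}Pb -Pa !Osorted.
pose active (x : rule_type q) := [&& (0 < x.1.2)%N, (x.2 < x.1.1 x.1.2)%N &
  [exists i : 'I_n, profile O i == x.1.1]].
(* A rule that is not in force gets the empty interval of agents from 1 to 0; the digit 1 is legal
   because [n] and [m] are positive. *)
pose digs (x : rule_type q) : seq nat :=
  if active x then [:: fa x.1.1; fb x.1.1; la x.1.2; ua x.1.2] else [:: 1; 0; 0; 0]%N.
pose dig k : nat :=
  if insub (k %/ 4)%N : option 'I_(rules q) is Some r then nth 0%N (digs (enum_val r)) (k %% 4)%N else 0%N.
have digE (r : 'I_(rules q)) c : (c < 4)%N -> dig (4 * r + c)%N = nth 0%N (digs (enum_val r)) c.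
  move=> c4; rewrite /dig mulnC divnMDl // divn_small // addn0 modnMDl modn_small //.
  by rewrite valK.
have act x : active x -> (fb x.1.1 < n)%N /\
    forall i, (i < n)%N -> (profile O i == x.1.1) = (fa x.1.1 <= i <= fb x.1.1)%N.
  by case/and3P => _ _ /existsP [i Hi]; apply: fab; exists i.
have dig_lt k : (dig k < n + m)%N.
  rewrite /dig; case: insubP => [r _ _|_]; last by rewrite addn_gt0 n0.
  rewrite /digs; case: ifP => [ax|_]; last first.
    by case: (k %% 4)%N => [|[|[|[|i]]]] /=; rewrite ?nth_nil; lia.
  have [fbn fE] := act _ ax.
  have [k0 _ /existsP [i]] := and3P ax; rewrite fE // => /andP[ai _].
  have [lm um _] := lu _ k0.
  case: (k %% 4)%N => [|[|[|[|c]]]] /=; rewrite ?nth_nil ?addn_gt0 ?n0 //.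
  - by rewrite ltn_addr // (leq_ltn_trans ai).
  - by rewrite ltn_addr.
  - by rewrite addnC ltn_addr.
  - by rewrite addnC ltn_addr.
exists dig; split=> // A.
pose D := flatten [seq [seq (i, nat_of_ord (x.1.2)) |
   i <- iota 0 (n + m) & [&& active x, (i < n)%N & (fa x.1.1 <= i <= fb x.1.1)%N]] | x <- [seq enum_val r | r <- enum 'I_(rules q)]].
have DE : demands n w (n + m) dig (rules q) = [seq (d.1, w (la d.2), w (ua d.2)) | d <- D].
  rewrite /demands /D map_flatten -map_comp; congr flatten.
  rewrite -(map_id (iota 0 _)) -val_enum_ord.
  rewrite -!map_comp; apply: eq_map => r /=.
  have e0 := digE r 0%N isT; rewrite addn0 in e0.
  rewrite /rule_demands -map_comp e0 !digE // /digs.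
  case: ifP => ax /=.
    by congr map; apply: eq_filter => i; rewrite ax.
  have e1 : [seq i <- iota 0 (n + m) | (i < n)%N && (0 < i <= 0)%N] = [::].
    by rewrite -(filter_pred0 (iota 0 (n + m))); apply: eq_filter => i /=; apply/negP; lia.
  by rewrite e1 filter_pred0.
have countD i k : (i < n)%N -> (0 < k)%N -> count_mem (i, k) D = cnt O i k.
  move=> ni k0; rewrite /D count_flatten sumnE 3!big_map big_enum /=.
  (* The contribution of one rule to the demands for [(i, k)]; summing over the copy number [t]
     gives [cnt O i k] back. *)
  pose G (x : rule_type q) : nat :=
    [&& x.1.1 == profile O i, (x.1.2 : nat) == k & (x.2 < cnt O i k)%N].
  rewrite (eq_bigr (fun r : 'I_(rules q) => G (enum_val r))) => [|r _]; last first.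
    move: (enum_val r) => x /=; rewrite count_map.
    rewrite (eq_count (a2 := fun i' => (x.1.2 == k :> nat) && (i' == i))); last first.
      by move=> i' /=; rewrite xpair_eqE andbC.
    have -> : count (fun i' => (x.1.2 == k :> nat) && (i' == i)) =1
       (fun s => (x.1.2 == k :> nat) * count_mem i s)%N.
      by case: (x.1.2 == k :> nat) => u; rewrite ?mul0n ?mul1n // count_pred0.
    rewrite count_uniq_mem ?filter_uniq ?iota_uniq // mem_filter mem_iota.
    rewrite leq0n add0n (ltn_addr _ ni) andbT ni /= /G.
    have [Ek|] := eqVneq (x.1.2 : nat) k; last by rewrite mul0n /= andbF.
    rewrite mul1n /=; congr nat_of_bool.
    have [ax|/negbTE nax] := boolP (active x).
      have [_ /(_ i ni) <-] := act x ax; rewrite eq_sym.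
      have /and3P[_ lt _] := ax.
      case: eqP => //= E; move: lt; rewrite E /profile ffunE Ek inordK ?ltnS ?Ocnt //.
    rewrite /=; apply/esym/negbTE; move/negbT: nax; apply: contra => /andP[/eqP E lt].
    rewrite /active Ek k0 /= E ffunE Ek inordK ?ltnS ?Ocnt // lt /=.
    by apply/existsP; exists (Ordinal ni).
  rewrite -(@big_enum_val _ _ _ (rule_type q) predT G) /=.
  rewrite -(pair_bigA _ (fun x t => G (x, t))) /=.
  rewrite -(pair_bigA _ (fun p k => \sum_(t < q.+1) G (p, k, t)))%N /=.
  rewrite (bigD1 (profile O i)) //= [X in (_ + X)%N]big1 ?addn0; last first.
    move=> p pO; rewrite big1 // => k' _; rewrite big1 // => t _.
    by rewrite /G /= (negbTE pO).
  have [kq|qk] := ltnP k (q ^ 2).+2; last first.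
    rewrite big1 => [|k' _]; last first.
      rewrite big1 // => t _; rewrite /G /= (_ : (k' == k :> nat) = false) ?andbF //.
      by apply/eqP => E; have := ltn_ord k'; rewrite E ltnNge qk.
    apply/esym/eq_card0 => j; rewrite !inE; apply/negbTE; rewrite negb_and orbC.
    apply/orP; left; apply/eqP => E; have := level_le lpos q0 (w j).
    by rewrite E ltnNge qk.
  rewrite (bigD1 (Ordinal kq)) //= [X in (_ + X)%N]big1 ?addn0; last first.
    move=> k' kk; rewrite big1 // => t _; rewrite /G /=.
    rewrite (_ : (k' == k :> nat) = false) ?andbF //.
    by apply: contraNF kk => /eqP E; apply/eqP/val_inj.
  rewrite /G /= !eqxx /=; exact: sum_ltn (Ocnt ni k0).
have DP d : d \in D -> (d.1 < n)%N && (0 < d.2)%N.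
  case/flattenP => s /mapP [x _ ->] /mapP [i]; rewrite mem_filter.
  by case/andP => /and3P[/and3P[k0 _ _] ni _] _ -> /=; rewrite ni.
have unass k : (0 < k)%N -> unassigned n m w l q (fun=> n) k = count (fun d => d.2 == k) D.
  move=> k0; rewrite (@count_snd n); last by move=> d /DP /andP[].
  rewrite (eq_bigr (fun i : 'I_n => cnt O i k)); last by move=> i _; rewrite countD.
  rewrite (eq_bigr (fun i : 'I_n => \sum_(j < m | lev j == k) (O j == i))%N); last first.
    move=> i _; rewrite level_countE [RHS]big_mkcond; apply: eq_bigr => j _.
    by case: (lev j == k); rewrite ?andbF ?andbT.
  rewrite exchange_big /= /unassigned -sum1_card.
  apply: eq_big => [j|j _]; first by rewrite !inE leqnn.
  rewrite (bigD1 (Ordinal (Opart (ltn_ord j)))) //= eqxx big1 // => i ij.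
  by apply/eqP; rewrite eqb0; apply: contra ij => /eqP E; apply/eqP/val_inj.
have lohi k j : (0 < k)%N -> (j < m)%N ->
  (exists2 j', (j' < m)%N & lev j' = k) -> (w (la k) <= w j <= w (ua k)) = (lev j == k).
  by move=> k0; have [_ _ H] := lu k k0; exact: H.
rewrite DE => /(picks_match lohi DP unass) [u [c g]]; split.
  move=> j jm; apply/idP/eqP => [Aj|l0].
    have [->//|k0] := posnP (lev j).
    have := u _ k0; rewrite /unassigned => /card0_eq /(_ (Ordinal jm)).
    by rewrite !inE /= Aj eqxx.
  by rewrite leqNgt; apply/negP => /(g j jm); rewrite ltnn l0.
move=> i k k0; rewrite c // countD // (_ : cnt (fun=> n) i k = 0%N) //.
by apply: eq_card0 => j; rewrite !inE (gtn_eqF (ltn_ord i)).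
Qed.

End GoodCode.

Lemma optimal_partition (R : realType) (n m : nat) (w : nat -> R) : (0 < n)%N ->
  exists2 O, is_partition n m O & forall S, is_partition n m S ->
  \prod_(i < n) bundle_w m w S i <= \prod_(i < n) bundle_w m w O i.
Proof.
move=> n0; pose F (f : {ffun 'I_m -> 'I_n}) (j : nat) : nat :=
  if insub j : option 'I_m is Some o then f o else 0%N.
pose val f := \prod_(i < n) bundle_w m w (F f) i.
have FE f (j : 'I_m) : F f j = f j by rewrite /F valK.
have [f _ fmax] := @arg_maxP _ R _ [ffun=> Ordinal n0] predT val isT.
exists (F f) => [j jm|S Sp]; first by rewrite (FE f (Ordinal jm)).
have := fmax [ffun j : 'I_m => Ordinal (Sp j (ltn_ord j))] isT.
congr (_ <= _); apply: eq_bigr => i _; apply: eq_bigl => j.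
by rewrite FE ffunE.
Qed.

(* Outcome of assigning the items left over by [A0] one by one to a least loaded machine. *)
Definition greedy_extension (R : realType) (n m : nat) (w : nat -> R) (A0 A : nat -> nat) :=
  [/\ is_partition n m A,
    forall j, (j < m)%N -> (A0 j < n)%N -> A j = A0 j &
    forall d, (forall j, (j < m)%N -> (n <= A0 j)%N -> w j <= d) ->
      forall j k, (j < m)%N -> (n <= A0 j)%N -> (k < n)%N ->
      bundle_w m w A (A j) <= bundle_w m w A k + d].

(** The code comes from a sorted optimum; [S] enters through its product, which makes the optimal
    product positive. *)
Theorem some_code_near_optimal (R : realType) (q n m : nat) (w : nat -> R) (S : nat -> nat) :
  (7 < q)%N -> (0 < n)%N -> nonneg_on m w -> is_partition n m S ->
  0 < \prod_(i < n) bundle_w m w S i ->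
  exists2 dig, (forall k, (dig k < n + m)%N) &
  forall A0 A, picks n m w (demands n w (n + m) dig (rules q)) (fun=> n) A0 ->
    greedy_extension n m w A0 A ->
    \prod_(i < n) bundle_w m w S i <=
      (1 + 20 / q%:R) ^+ n * \prod_(i < n) bundle_w m w A i.
Proof.
move=> q0 n0 w0 Sp Spos.
have [O1 O1p O1max] := @optimal_partition R n m w n0.
have O1pos := lt_le_trans Spos (O1max S Sp).
have [i0 _ i0min] := @arg_minP _ R 'I_n (Ordinal n0) predT (bundle_w m w O1) isT.
set l := bundle_w m w O1 i0 in i0min.
have l0 : 0 < l by apply: (@opt_bundle_gt0 R n m w w0 O1).
pose key i := nat_of_ord (enum_rank (profile m w l q O1 i)).
have [O [f [Op fn fsurj OE [srt prodE]]]] := @sort_machines R n m w O1 key O1p.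
have Omax T : is_partition n m T ->
  \prod_(i < n) bundle_w m w T i <= \prod_(i < n) bundle_w m w O i.
  by move=> Tp; rewrite prodE; exact: O1max.
have Opos : 0 < \prod_(i < n) bundle_w m w O i by rewrite prodE.
have bE p : (p < n)%N -> bundle_w m w O p = bundle_w m w O1 (f p).
  by move=> pn; apply: eq_bigl => j; rewrite OE.
have cE p k : (p < n)%N -> level_count m w l q O p k = level_count m w l q O1 (f p) k.
  by move=> pn; apply: eq_card => j; rewrite !inE OE.
have m0 : (0 < m)%N.
  rewrite lt0n; apply/negP => /eqP mz; have := @opt_bundle_gt0 R n m w w0 O1 O1pos (Ordinal n0).
  by rewrite /bundle_w big1 ?ltxx // => j; have := ltn_ord j; move: (nat_of_ord j) => x; rewrite mz.
have lmin (i : 'I_n) : l <= bundle_w m w O i.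
  by rewrite bE //; have := i0min (Ordinal (fn i (ltn_ord i))) isT.
have latt : exists i : 'I_n, bundle_w m w O i = l.
  have [p pn fp] := fsurj i0 (ltn_ord i0).
  by exists (Ordinal pn); rewrite bE //= fp.
have Ocnt i k : (i < n)%N -> (0 < k)%N -> (level_count m w l q O i k <= q.+1)%N.
  by move=> ni k0; apply: (level_count_le w0 Op Omax Opos q0 latt (Ordinal ni)).
have Osrt i i' : (i <= i' < n)%N ->
  (enum_rank (profile m w l q O i) <= enum_rank (profile m w l q O i'))%N.
  have pE p : (p < n)%N -> profile m w l q O p = profile m w l q O1 (f p).
    by move=> pn; apply/ffunP => k; rewrite !ffunE cE.
  move=> ii'; have /andP[le1 i'n] := ii'.
  by rewrite !pE //; [exact: srt|exact: leq_ltn_trans i'n].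
have [dig [dN H]] := good_code_exists q0 Op l0 Ocnt Osrt n0 m0.
exists dig => // A0 A /H [un cA0] [Ap Aext Agr].
apply: (le_trans (Omax S Sp)).
apply: (matched_greedy_near_optimal w0 Op Omax Opos q0 lmin latt Ap).
- move=> i k k0; rewrite -cA0 //; apply: eq_card => j; rewrite !inE.
  have [A0j|A0j] := ltnP (A0 j) n; first by rewrite Aext.
  have := un j (ltn_ord j); rewrite A0j => /esym/eqP ->.
  by rewrite (ltn_eqF k0) !andbF.
(* Items left over by the rules have level 0, so the greedy imbalance is at most [l / q]. *)
- move=> j k lj; apply: Agr => //.
    by move=> x xm; rewrite un // level0.
  by rewrite un // lj.
Qed.

Lemma foldl_iota_ind (T : Type) (P : nat -> T -> Prop) (f : T -> nat -> T) s N :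
  P 0%N s -> (forall i s, (i < N)%N -> P i s -> P i.+1 (f s i)) ->
  P N (foldl f s (iota 0 N)).
Proof.
move=> P0 Pf; elim: N Pf => [//|N IH] Pf.
rewrite -addn1 iotaD foldl_cat /= addn1; apply: (Pf) => //.
by apply: IH => i s' iN; apply: Pf; exact: ltnW.
Qed.

(** * Which parts of the state a command can change *)

Section Frame.

Fixpoint writes_n (c : cmd) (x : nat) : bool :=
  match c with
  | NZero y | NInc y | NMov y _ | NDig y _ | NLd y _ _ => x == y
  | Seq c1 c2 | IfN _ _ c1 c2 | IfR _ _ c1 c2 => writes_n c1 x || writes_n c2 x
  | For y c => (x == y) || writes_n c x
  | _ => false
  end.

Fixpoint writes_r (c : cmd) (x : nat) : bool :=
  match c with
  | RZero y | ROne y | RAdd y _ | RMul y _ | RCast y _ | RLd y _ _ | ILd y _ => x == y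
  | Seq c1 c2 | IfN _ _ c1 c2 | IfR _ _ c1 c2 => writes_r c1 x || writes_r c2 x
  | For y c => writes_r c x
  | _ => false
  end.

Fixpoint writes_d (c : cmd) : bool :=
  match c with
  | DMov _ _ => true
  | Seq c1 c2 | IfN _ _ c1 c2 | IfR _ _ c1 c2 => writes_d c1 || writes_d c2
  | For y c => writes_d c
  | _ => false
  end.

Fixpoint writes_na (c : cmd) (a : bool) : bool :=
  match c with
  | NSt a' _ _ => a == a'
  | Seq c1 c2 | IfN _ _ c1 c2 | IfR _ _ c1 c2 => writes_na c1 a || writes_na c2 a
  | For y c => writes_na c a
  | _ => false
  end.

Fixpoint writes_ra (c : cmd) (a : bool) : bool :=
  match c with
  | RSt a' _ _ => a == a'
  | Seq c1 c2 | IfN _ _ c1 c2 | IfR _ _ c1 c2 => writes_ra c1 a || writes_ra c2 a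
  | For y c => writes_ra c a
  | _ => false
  end.

Variables (R : realType) (N : nat).

Lemma run_sn c x (s : state R) : ~~ writes_n c x -> sn (run N c s) x = sn s x.
Proof.
elim: c s => /=; try by move=> *; rewrite fsetN.
all: try by move=> *; case: ifP.
all: try by [].
- by move=> c1 IH1 c2 IH2 s; rewrite negb_or => /andP[w1 w2]; rewrite IH2 // IH1.
- by move=> y z c1 IH1 c2 IH2 s; rewrite negb_or => /andP[w1 w2]; case: ifP => _; rewrite ?IH2 // IH1.
- by move=> y z c1 IH1 c2 IH2 s; rewrite negb_or => /andP[w1 w2]; case: ifP => _; rewrite ?IH2 // IH1.
- move=> y c IH s; rewrite negb_or => /andP[w1 w2].
  apply: (@foldl_iota_ind _ (fun _ s' => sn s' x = sn s x)) => // i s' _ E.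
  by rewrite IH //= fsetN.
Qed.

Lemma run_sr c x (s : state R) : ~~ writes_r c x -> sr (run N c s) x = sr s x.
Proof.
elim: c s => /=; try by move=> *; rewrite fsetN.
all: try by [].
- by move=> c1 IH1 c2 IH2 s; rewrite negb_or => /andP[w1 w2]; rewrite IH2 // IH1.
- by move=> y i s xy; case: ifP => //= _; rewrite fsetN.
- by move=> y i s xy; case: ifP.
- by move=> y z c1 IH1 c2 IH2 s; rewrite negb_or => /andP[w1 w2]; case: ifP => _; rewrite ?IH2 // IH1.
- by move=> y z c1 IH1 c2 IH2 s; rewrite negb_or => /andP[w1 w2]; case: ifP => _; rewrite ?IH2 // IH1.
- move=> y c IH s w1.
  by apply: (@foldl_iota_ind _ (fun _ s' => sr s' x = sr s x)) => // i s' _ E; rewrite IH.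
Qed.

Lemma run_dg c (s : state R) : ~~ writes_d c -> dg (run N c s) = dg s.
Proof.
elim: c s => //=; try by move=> *; case: ifP.
- by move=> c1 IH1 c2 IH2 s; rewrite negb_or => /andP[w1 w2]; rewrite IH2 // IH1.
- by move=> y z c1 IH1 c2 IH2 s; rewrite negb_or => /andP[w1 w2]; case: ifP => _; rewrite ?IH2 // IH1.
- by move=> y z c1 IH1 c2 IH2 s; rewrite negb_or => /andP[w1 w2]; case: ifP => _; rewrite ?IH2 // IH1.
- move=> y c IH s w1.
  by apply: (@foldl_iota_ind _ (fun _ s' => dg s' = dg s)) => // i s' _ E; rewrite IH.
Qed.

Lemma run_na c a (s : state R) : ~~ writes_na c a -> na (run N c s) a = na s a.
Proof.
elim: c s => //=; try by move=> *; rewrite fsetN.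
all: try by move=> *; case: ifP.
- by move=> c1 IH1 c2 IH2 s; rewrite negb_or => /andP[w1 w2]; rewrite IH2 // IH1.
- by move=> y z c1 IH1 c2 IH2 s; rewrite negb_or => /andP[w1 w2]; case: ifP => _; rewrite ?IH2 // IH1.
- by move=> y z c1 IH1 c2 IH2 s; rewrite negb_or => /andP[w1 w2]; case: ifP => _; rewrite ?IH2 // IH1.
- move=> y c IH s w1.
  by apply: (@foldl_iota_ind _ (fun _ s' => na s' a = na s a)) => // i s' _ E; rewrite IH.
Qed.

Lemma run_ra c a (s : state R) : ~~ writes_ra c a -> ra (run N c s) a = ra s a.
Proof.
elim: c s => //=; try by move=> *; rewrite fsetN.
all: try by move=> *; case: ifP.
- by move=> c1 IH1 c2 IH2 s; rewrite negb_or => /andP[w1 w2]; rewrite IH2 // IH1.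
- by move=> y z c1 IH1 c2 IH2 s; rewrite negb_or => /andP[w1 w2]; case: ifP => _; rewrite ?IH2 // IH1.
- by move=> y z c1 IH1 c2 IH2 s; rewrite negb_or => /andP[w1 w2]; case: ifP => _; rewrite ?IH2 // IH1.
- move=> y c IH s w1.
  by apply: (@foldl_iota_ind _ (fun _ s' => ra s' a = ra s a)) => // i s' _ E; rewrite IH.
Qed.

Lemma run_seq c1 c2 (s : state R) : run N (Seq c1 c2) s = run N c2 (run N c1 s).
Proof. by []. Qed.

Lemma run_for x c (s : state R) :
  run N (For x c) s = foldl (fun s i => run N c (setn s x i)) s (iota 0 N).
Proof. by []. Qed.

Lemma run_ifn x y c1 c2 (s : state R) :
  run N (IfN x y c1 c2) s = if (sn s x <= sn s y)%N then run N c1 s else run N c2 s.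
Proof. by []. Qed.

Lemma run_ifr x y c1 c2 (s : state R) :
  run N (IfR x y c1 c2) s = if sr s x <= sr s y then run N c1 s else run N c2 s.
Proof. by []. Qed.

End Frame.

(* The program *)
Declare Scope cmd_scope.
Delimit Scope cmd_scope with cmd.
Notation "c1 ;; c2" := (Seq c1 c2) (at level 60, right associativity) : cmd_scope.
Local Open Scope cmd_scope.

(* Nat variables: 0 = n, 1 = m; nat arrays: [false] = current assignment, [true] = best one;
   real arrays: [false] = weights, [true] = loads; real variable 7 = best product. *)

Definition assign_cmd j i :=
  NSt false j i ;; RLd 3 true i ;; RLd 4 false j ;; RAdd 3 4 ;; RSt true i 3.

(** Variable 8 is expected to hold [m], meaning that nothing is found; each match overwrites it, so
    the last one wins. Loops always run over [n + m] values, and [IfN 1 3 Skip] discards those that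
    are not items. *)
Definition scan_cmd :=
  For 3 (IfN 1 3 Skip (NLd 9 false 3 ;; IfN 0 9
    (RLd 5 false 3 ;; IfR 1 5 (IfR 5 2 (NMov 8 3) Skip) Skip) Skip)).

Definition pick_cmd := NMov 8 1 ;; scan_cmd ;; IfN 1 8 Skip (assign_cmd 8 2).

Definition rule_cmd r :=
  NDig 4 (4 * r) ;; NDig 5 (4 * r + 1) ;; NDig 6 (4 * r + 2) ;; NDig 7 (4 * r + 3) ;;
  RLd 1 false 6 ;; RLd 2 false 7 ;;
  For 2 (IfN 0 2 Skip (IfN 4 2 (IfN 2 5 pick_cmd Skip) Skip)).

Fixpoint rules_cmd Q := if Q is r.+1 then rules_cmd r ;; rule_cmd r else Skip.

Definition argmin_cmd :=
  NZero 8 ;; For 2 (IfN 0 2 Skip (RLd 5 true 2 ;; RLd 6 true 8 ;; IfR 6 5 Skip (NMov 8 2))).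

Definition greedy_cmd :=
  For 3 (IfN 1 3 Skip (NLd 9 false 3 ;; IfN 0 9 (argmin_cmd ;; assign_cmd 3 8) Skip)).

Definition product_cmd := ROne 8 ;; For 2 (IfN 0 2 Skip (RLd 6 true 2 ;; RMul 8 6)).

Definition record_cmd :=
  RZero 7 ;; RAdd 7 8 ;; For 3 (IfN 1 3 Skip (NLd 9 false 3 ;; NSt true 3 9)).

Definition init_cmd := RZero 3 ;; For 2 (NSt false 2 0 ;; RSt true 2 3).

Definition body_cmd Q :=
  init_cmd ;; rules_cmd Q ;; greedy_cmd ;; product_cmd ;; IfR 7 8 record_cmd Skip.

(** The nested loops share variable 10, whose value goes at once into the digit [k']. At depth
    [4 * Q], a constant for fixed [q], the body runs [(n + m) ^ (4 * Q)] times. *)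
Fixpoint enum_cmd Q k :=
  if k is k'.+1 then For 10 (DMov k' 10 ;; enum_cmd Q k') else body_cmd Q.

(** * Correctness of the program *)

Section BodyCorrectness.
Variables (R : realType) (n m : nat) (w : nat -> R).
Hypothesis n0 : (0 < n)%N.
Hypothesis w0 : nonneg_on m w.
Local Notation N := (n + m)%N.
Local Notation bw := (bundle_w m w).
Implicit Type s : state R.

Record env s : Prop := Env {
  env_n : sn s 0 = n; env_m : sn s 1 = m; env_w : ra s false = w }.

Definition loads s := forall i, (i < n)%N -> ra s true i = bw (na s false) i.

Lemma env_run c s : ~~ writes_n c 0 -> ~~ writes_n c 1 -> ~~ writes_ra c false ->
  env s -> env (run N c s).
Proof.
by move=> h0 h1 h2 [e0 e1 e2]; split; rewrite ?run_sn ?run_ra.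
Qed.

Lemma bundle_assign (A : nat -> nat) j i k : (j < m)%N -> (n <= A j)%N -> (i < n)%N -> (k < n)%N ->
  bw (fset A j i) k = if k == i then bw A k + w j else bw A k.
Proof.
move=> jm Aj ni nk; rewrite (@bundle_move _ _ _ A (Ordinal jm)) /=; last first.
  by apply/eqP => E; lia.
case: eqP => // _; case: eqP => // E; lia.
Qed.

Lemma assign_correct x y s : env s -> loads s ->
  (sn s x < m)%N -> (n <= na s false (sn s x))%N -> (sn s y < n)%N ->
  let s' := run N (assign_cmd x y) s in
  na s' false = fset (na s false) (sn s x) (sn s y) /\ loads s'.
Proof.
move=> [e0 e1 e2] ls xm Ax yn /=; split=> // k nk /=.
rewrite bundle_assign // {1}/fset /= /fset /= e2.
by case: eqP => [->|_]; rewrite ls.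
Qed.

(** Masking the cells from [m] on makes the start exactly the constant [n] from which [picks] is run
    in the analysis. *)
Definition assignment s : nat -> nat := fun j => if (j < m)%N then na s false j else n.

Lemma pick_correct s i : env s -> loads s -> sn s 2 = i -> (i < n)%N ->
  let s' := run N pick_cmd s in
  loads s' /\ pick_step n m w (i, sr s 1, sr s 2) (assignment s) (assignment s').
Proof.
move=> es ls si ni.
pose s1 := run N scan_cmd (setn s 8 (sn s 1)).
have sn1 x : x != 3%N -> x != 8%N -> x != 9%N -> sn s1 x = sn s x.
  move=> x3 x8 x9; rewrite /s1 run_sn /= ?fsetN //.
  by rewrite (negbTE x3) (negbTE x8) (negbTE x9).
have es1 : env s1.
  case: es => e0 e1 e2; split; rewrite ?sn1 //.
  by rewrite /s1 run_ra.
have na1 : na s1 false = na s false by rewrite /s1 run_na.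
have ls1 : loads s1 by move=> k nk; rewrite na1 /s1 run_ra //= ls.
have inv : (sn s1 8 = m /\ (forall j, (j < N)%N -> (j < m)%N -> (n <= na s false j)%N ->
      ~ (sr s 1 <= w j <= sr s 2))) \/
    [/\ (sn s1 8 < m)%N, (n <= na s false (sn s1 8))%N & sr s 1 <= w (sn s1 8) <= sr s 2].
  (* Invariant: variable 8 is still [m] and no scanned item qualifies, or it is a qualifying
     item. *)
  pose P t s' := [/\ env s', na s' false = na s false, sr s' 1 = sr s 1 /\ sr s' 2 = sr s 2 &
   (sn s' 8 = m /\ (forall j, (j < t)%N -> (j < m)%N -> (n <= na s false j)%N ->
      ~ (sr s 1 <= w j <= sr s 2))) \/
    [/\ (sn s' 8 < m)%N, (n <= na s false (sn s' 8))%N & sr s 1 <= w (sn s' 8) <= sr s 2]].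
  suff : P N s1 by case.
  apply: foldl_iota_ind => [|t s' tN [es' na' [r1 r2] H]].
    case: es => e0 e1 e2; split=> //.
    by left; split=> //=; rewrite /fset.
  have [e0 e1 e2] := es'.
  rewrite /= /fset /= e1; case: leqP => [mt|tm].
    split=> //; case: H => [[h1 h2]|h]; [left|by right].
    by split=> // j jt jm; apply: h2 => //; exact: leq_trans jm mt.
  rewrite /= /fset /= e0 na'; case: leqP => [nA|An].
    have keep (s2 : state R) : env s2 -> na s2 false = na s false ->
      sr s2 1 = sr s 1 -> sr s2 2 = sr s 2 -> sn s2 8 = sn s' 8 ->
      ~ (sr s 1 <= w t <= sr s 2) -> P t.+1 s2.
      move=> q1 q2 q3 q4 q5 no; split=> //; rewrite q5; case: H => [[h1 h2]|h]; [left|by right].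
      split=> // j; rewrite ltnS leq_eqVlt => /predU1P[->//|jt]; exact: h2.
    rewrite /= /fset /= e2 r1; case: leP => lo; last first.
      apply: keep => //=; last by rewrite leNgt lo.
    rewrite /= /fset /= r2; case: leP => hi; last first.
      by apply: keep => //=; rewrite lo leNgt hi.
    by split=> //; right; rewrite /= /fset /= tm nA lo hi.
  split=> //; case: H => [[h1 h2]|h]; [left|by right].
  split=> // j; rewrite ltnS leq_eqVlt => /predU1P[->|jt]; last exact: h2.
  by move=> _; rewrite leqNgt An.
cbv zeta; have -> : run N pick_cmd s = run N (IfN 1 8 Skip (assign_cmd 8 2)) s1.
  by rewrite /pick_cmd run_seq run_seq.
rewrite run_ifn (env_m es1).
case: inv => [[-> no]|[lt nA lh]].
  rewrite leqnn; split=> //; right; split; last by rewrite /assignment na1.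
  by move=> j jm; rewrite /assignment jm; apply: no => //; lia.
rewrite leqNgt lt.
have s2i : sn s1 2 = i by rewrite sn1.
have [||E ls2] := @assign_correct 8 2 s1 es1 ls1 lt; [by rewrite na1|by rewrite s2i|].
split; first exact: ls2.
left; exists (sn s1 8); split=> //; first by rewrite /assignment lt.
apply/funext => j; rewrite {1}/assignment E na1 s2i /assignment /fset.
by case: ltnP => //; case: eqP => // ->; rewrite leqNgt lt.
Qed.

Lemma rule_correct s r : env s -> loads s ->
  let s' := run N (rule_cmd r) s in
  loads s' /\ picks n m w (rule_demands n w N (dg s) r) (assignment s) (assignment s').
Proof.
move=> es ls; have [e0 e1 e2] := es.
pose d c := dg s (4 * r + c)%N.
pose s0 := run N (NDig 4 (4 * r) ;; NDig 5 (4 * r + 1) ;; NDig 6 (4 * r + 2) ;;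
  NDig 7 (4 * r + 3) ;; RLd 1 false 6 ;; RLd 2 false 7) s.
pose c := IfN 0 2 Skip (IfN 4 2 (IfN 2 5 pick_cmd Skip) Skip).
have rE : run N (rule_cmd r) s = run N (For 2 c) s0 by [].
cbv zeta; rewrite {}rE.
pose P t s' := [/\ env s', loads s', [/\ sn s' 4 = dg s (4 * r)%N, sn s' 5 = dg s (4 * r + 1)%N,
    sr s' 1 = w (d 2%N) & sr s' 2 = w (d 3%N)] &
  picks n m w [seq (i, w (d 2%N), w (d 3%N))
    | i <- iota 0 t & (i < n)%N && (dg s (4 * r)%N <= i <= dg s (4 * r + 1)%N)%N]
    (assignment s) (assignment s')].
suff : P N (run N (For 2 c) s0) by case.
apply: foldl_iota_ind => [|t s' tN [es' ls' [v4 v5 r1 r2] H]].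
  split; [by split|by []| |by []].
  by split; rewrite /s0 /= /fset /= ?e2.
have setE : [/\ env (setn s' 2 t), loads (setn s' 2 t) & assignment (setn s' 2 t) = assignment s'].
  by split=> //; case: es' => f0 f1 f2; split.
case: setE => es2 ls2 as2.
have skip : ~~ ((t < n)%N && (dg s (4 * r)%N <= t <= dg s (4 * r + 1)%N)%N) ->
    P t.+1 (setn s' 2 t).
  move=> no; split=> //.
  by rewrite -(addn1 t) iotaD filter_cat /= (negbTE no) cats0.
change (P t.+1 (run N c (setn s' 2 t))).
have n2 : sn (setn s' 2 t) 2 = t by rewrite /= fsetE.
have n4 : sn (setn s' 2 t) 4 = dg s (4 * r)%N by rewrite /= fsetN.
have n5 : sn (setn s' 2 t) 5 = dg s (4 * r + 1)%N by rewrite /= fsetN.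
rewrite /c run_ifn (env_n es2) n2; case: leqP => nt.
  by apply: skip; rewrite ltnNge nt.
rewrite run_ifn n2 n4; case: leqP => at_; last by apply: skip; rewrite nt (leqNgt _ t) at_.
rewrite run_ifn n2 n5; case: leqP => tb; last by apply: skip; rewrite nt at_ (leqNgt t) tb.
have [ls3 pk] := @pick_correct (setn s' 2 t) t es2 ls2 erefl nt.
have es3 : env (run N pick_cmd (setn s' 2 t)) by apply: env_run.
have k4 : sn (run N pick_cmd (setn s' 2 t)) 4 = dg s (4 * r)%N by rewrite run_sn.
have k5 : sn (run N pick_cmd (setn s' 2 t)) 5 = dg s (4 * r + 1)%N by rewrite run_sn.
have k1 : sr (run N pick_cmd (setn s' 2 t)) 1 = w (d 2%N) by rewrite run_sr.
have k2 : sr (run N pick_cmd (setn s' 2 t)) 2 = w (d 3%N) by rewrite run_sr.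
move: pk; rewrite as2 [sr _ 1]r1 [sr _ 2]r2.
move: (run N pick_cmd (setn s' 2 t)) ls3 es3 k4 k5 k1 k2 => s3 ls3 es3 k4 k5 k1 k2 pk.
split=> //; rewrite -(addn1 t) iotaD filter_cat map_cat /= nt at_ tb /=.
by apply: picks_cat H _; exists (assignment s3).
Qed.

Lemma rules_frame Q : [/\ ~~ writes_n (rules_cmd Q) 0, ~~ writes_n (rules_cmd Q) 1,
  ~~ writes_r (rules_cmd Q) 7, ~~ writes_d (rules_cmd Q)
  & ~~ writes_na (rules_cmd Q) true && ~~ writes_ra (rules_cmd Q) false].
Proof.
elim: Q => [//|Q [h1 h2 h3 h4 /andP[h5 h6]]].
by split; rewrite /= !negb_or ?h1 ?h2 ?h3 ?h4 ?h5 ?h6.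
Qed.

Lemma rules_correct s Q : env s -> loads s ->
  let s' := run N (rules_cmd Q) s in
  loads s' /\ picks n m w (demands n w N (dg s) Q) (assignment s) (assignment s').
Proof.
move=> es ls; elim: Q => [//|Q [ls1 p1]].
cbv zeta; rewrite -[rules_cmd Q.+1]/(rules_cmd Q ;; rule_cmd Q) run_seq.
have [h1 h2 h3 h4 /andP[h5 h6]] := rules_frame Q.
have [ls2] := @rule_correct (run N (rules_cmd Q) s) Q (env_run h1 h2 h6 es) ls1.
rewrite run_dg //; move: (run N (rule_cmd Q) _) ls2 => s2 ls2 p2.
split=> //; rewrite /demands -(addn1 Q) iotaD map_cat flatten_cat /= cats0.
exact: picks_cat p1 p2.
Qed.

Lemma argmin_correct s : env s ->
  let s' := run N argmin_cmd s in
  (sn s' 8 < n)%N /\ forall k, (k < n)%N -> ra s true (sn s' 8) <= ra s true k.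
Proof.
move=> es; pose P t s' := [/\ env s', ra s' true = ra s true, (sn s' 8 < n)%N &
  forall k, (k < t)%N -> (k < n)%N -> ra s true (sn s' 8) <= ra s true k].
suff [_ _ h1 h2] : P N (run N argmin_cmd s).
  by split=> // k kn; apply: h2 => //; rewrite ltn_addr.
rewrite /argmin_cmd run_seq; apply: foldl_iota_ind => [|t s' tN [es' rE h1 h2]].
  by case: es => e0 e1 e2.
have [e0 e1 e2] := es'; rewrite /= /fset /= e0 rE.
case: leqP => nt.
  by split=> // k kt kn; apply: h2 => //; apply: leq_trans kn nt.
case: leP => le.
  split=> // k; rewrite ltnS leq_eqVlt => /predU1P[->|]; [by []|exact: h2].
split=> //= k; rewrite /fset /= ltnS leq_eqVlt => /predU1P[->//|kt kn].
by apply: (le_trans (ltW le)); apply: h2.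
Qed.

(** An agent that is least loaded when it receives an item exceeds every other load by at most the
    weight of that item. Later items either raise another load or go to the same agent when it is
    least loaded again. *)
Lemma greedy_correct s : env s -> loads s ->
  let s' := run N greedy_cmd s in
  loads s' /\ greedy_extension n m w (assignment s) (na s' false).
Proof.
move=> es ls; pose A0 := assignment s.
pose P t s' := [/\ env s', loads s',
  forall j, (j < t)%N -> (j < m)%N -> (na s' false j < n)%N,
  (forall j, (j < m)%N -> (A0 j < n)%N -> na s' false j = A0 j) /\
  (forall j, (t <= j)%N -> (j < m)%N -> na s' false j = A0 j) &
  forall d, (forall j, (j < m)%N -> (n <= A0 j)%N -> w j <= d) ->
    forall j k, (j < t)%N -> (j < m)%N -> (n <= A0 j)%N -> (k < n)%N ->
      bw (na s' false) (na s' false j) <= bw (na s' false) k + d].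
suff [_ ls' lt [ext _] gr] : P N (run N greedy_cmd s).
  have jN j : (j < m)%N -> (j < N)%N by move=> jm; rewrite addnC ltn_addr.
  split=> //; split=> //.
  - by move=> j jm; apply: lt => //; exact: jN.
  - by move=> d dP j k jm nA kn; apply: (gr d dP) => //; exact: jN.
apply: foldl_iota_ind => [|t s' tN [es' ls' lt [ext rest] gr]].
  by split=> //; split=> j; rewrite /A0 /assignment; [move=> ->|move=> _ ->].
have [e0 e1 e2] := es'.
set s1 := setn s' 3 t.
pose s2 := setn s1 9 (na s' false t).
have es2 : env s2 by split.
have ls2 : loads s2 by [].
pose c := IfN 1 3 Skip (NLd 9 false 3 ;; IfN 0 9 (argmin_cmd ;; assign_cmd 3 8) Skip).
change (P t.+1 (run N c s1)).
have n1 : sn s1 1 = m by rewrite /= fsetN.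
have n3 : sn s1 3 = t by rewrite /= fsetE.
have es1 : env s1 by split.
rewrite /c run_ifn n1 n3; case: leqP => mt.
  split=> //.
  - by move=> j jt jm; apply: lt => //; exact: leq_trans jm mt.
  - by split=> // j tj jm; apply: rest => //; exact: ltnW.
  - by move=> d dP j k jt jm; apply: (gr d dP) => //; exact: leq_trans jm mt.
have -> : run N (NLd 9 false 3 ;; IfN 0 9 (argmin_cmd ;; assign_cmd 3 8) Skip) s1 =
  run N (IfN 0 9 (argmin_cmd ;; assign_cmd 3 8) Skip) s2.
  by rewrite run_seq /= fsetE.
have At : na s' false t = A0 t by apply: rest.
have n9 : sn s2 9 = A0 t by rewrite /= fsetE.
rewrite run_ifn (env_n es2) n9.
case: leqP => [nA|An]; last first.
  split=> //.
  - move=> j; rewrite ltnS leq_eqVlt => /predU1P[->|jt] jm; last exact: lt.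
    by rewrite [na _ _ _]At.
  - by split=> // j tj jm; apply: rest => //; exact: ltnW.
  - move=> d dP j k; rewrite ltnS leq_eqVlt => /predU1P[->|jt] jm nA kn.
      by move: nA; rewrite leqNgt An.
    exact: (gr d dP).
rewrite run_seq; have [lt3 min3] := argmin_correct es2.
have es3 : env (run N argmin_cmd s2) by apply: env_run.
have ls3 : loads (run N argmin_cmd s2).
  by move=> i ni; rewrite run_ra // run_na //; exact: ls2.
have t3 : sn (run N argmin_cmd s2) 3 = t by rewrite run_sn //= fsetN // fsetE.
have na3 : na (run N argmin_cmd s2) false = na s' false by rewrite run_na.
move: (run N argmin_cmd s2) lt3 min3 es3 ls3 t3 na3 => s3 lt3 min3 es3 ls3 t3 na3.
have [|||E ls4] := @assign_correct 3 8 s3 es3 ls3.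
- by rewrite t3.
- by rewrite t3 na3 At.
- by [].
have es4 : env (run N (assign_cmd 3 8) s3) by apply: env_run.
move: (run N (assign_cmd 3 8) s3) E ls4 es4 => s4; rewrite t3 na3 => E ls4 es4.
set i := sn s3 8 in lt3 min3 E.
have Ani : (n <= na s' false t)%N by rewrite At.
have bA k : (k < n)%N -> bw (na s4 false) k = if k == i then bw (na s' false) k + w t else bw (na s' false) k.
  by move=> kn; rewrite E bundle_assign.
have wt : 0 <= w t by apply: w0.
have bmono k : (k < n)%N -> bw (na s' false) k <= bw (na s4 false) k.
  by move=> kn; rewrite bA //; case: eqP => _; rewrite ?lerDl.
have imin k : (k < n)%N -> bw (na s' false) i <= bw (na s' false) k.
  move=> kn; have := min3 k kn.
  rewrite -[ra s2 true]/(ra s' true) !ls' //.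
have bi d k : w t <= d -> (k < n)%N -> bw (na s4 false) i <= bw (na s4 false) k + d.
  by move=> wd kn; rewrite (bA i) // eqxx lerD // (le_trans (imin k kn)) // bmono.
split=> //.
- move=> j; rewrite ltnS leq_eqVlt E /fset => /predU1P[->|jt] jm; first by rewrite eqxx.
  by case: eqP => // _; exact: lt.
- split=> j.
    move=> jm A0j; rewrite E fsetN ?ext //; apply/eqP => jt.
    by move: A0j; rewrite jt ltnNge nA.
  move=> tj jm; rewrite E fsetN ?rest ?(ltnW tj) //; by rewrite gtn_eqF.
- move=> d dP j k; rewrite ltnS => jt jm Aj kn.
  have wd : w t <= d by apply: dP.
  have [jE|jNt] := eqVneq j t.
    by rewrite [na s4 false j](_ : _ = i); [exact: bi|rewrite E jE fsetE].
  have jlt : (j < t)%N by rewrite ltn_neqAle jNt.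
  have -> : na s4 false j = na s' false j by rewrite E fsetN.
  have [->|ji] := eqVneq (na s' false j) i; first exact: bi.
  rewrite bA ?lt // (negbTE ji).
  apply: (le_trans (gr d dP j k jlt jm Aj kn)).
  by rewrite lerD2r bmono.
Qed.

Definition best_of s := \prod_(i < n) bw (na s true) i.

(** [good_tail] is about payments: the output cells after the items are read from the same array, so
    they are 0. [good_value] is an inequality because the start value 0 is not the product of an
    evaluated allocation. *)
Record good s : Prop := Good {
  good_env : env s;
  good_range : forall j, (j < m)%N -> (na s true j < n)%N;
  good_tail : forall j, (m <= j)%N -> na s true j = 0%N;
  good_value : sr s 7 <= best_of s }.

Definition achieved Q (dig : nat -> nat) (v : R) := exists A0 A,
  [/\ picks n m w (demands n w N dig Q) (fun=> n) A0, greedy_extension n m w A0 A &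
   \prod_(i < n) bw A i <= v].

Lemma achieved_le Q dig u v : u <= v -> achieved Q dig u -> achieved Q dig v.
Proof.
by move=> uv [A0 [A [h1 h2 h3]]]; exists A0, A; split=> //; exact: le_trans uv.
Qed.

Lemma init_correct s : env s ->
  let s' := run N init_cmd s in loads s' /\ assignment s' = (fun=> n).
Proof.
move=> es; pose P t s' := [/\ env s', sr s' 3 = 0 &
  forall j, (j < t)%N -> na s' false j = n /\ ra s' true j = 0].
suff [_ _ H] : P N (run N init_cmd s).
  have na' j : (j < m)%N -> na (run N init_cmd s) false j = n.
    by move=> jm; apply: (H j _).1; rewrite addnC ltn_addr.
  split=> [i ni|]; last first.
    by apply/funext => j; rewrite /assignment; case: ltnP => // /na'.
  rewrite (H i _).2 ?ltn_addr // /bundle_w big_pred0 // => j.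
  by rewrite na' // gtn_eqF.
rewrite /init_cmd run_seq; apply: foldl_iota_ind => [|t s' tN [[e0 e1 e2] s3 H]].
  by case: es => e0 e1 e2; split=> //; split.
split; [by split|by []|].
move=> j; rewrite ltnS leq_eqVlt /= /fset /= => /predU1P[->|jt].
  by rewrite eqxx.
by rewrite ltn_eqF //; exact: H.
Qed.

Lemma product_correct s : env s -> loads s ->
  sr (run N product_cmd s) 8 = \prod_(i < n) bw (na s false) i.
Proof.
move=> es ls; pose P t s' := [/\ env s', ra s' true = ra s true &
  sr s' 8 = \prod_(0 <= i < minn t n) bw (na s false) i].
suff [_ _ ->] : P N (run N product_cmd s).
  by rewrite (minn_idPr (leq_addr _ _)) big_mkord.
rewrite /product_cmd run_seq; apply: foldl_iota_ind => [|t s' tN [[e0 e1 e2] rE H]].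
  by case: es => e0 e1 e2; split; rewrite ?min0n ?big_geq.
rewrite /= /fset /= e0; case: leqP => nt.
  by split=> //=; rewrite H !(minn_idPr _) // ltnW.
split=> //=; rewrite /fset /= H rE ls //.
by rewrite (minn_idPl (ltnW nt)) (minn_idPl nt) big_nat_recr.
Qed.

Lemma record_correct s : env s -> 
  let s' := run N record_cmd s in
  sr s' 7 = sr s 8 /\
  forall j, na s' true j = if (j < m)%N then na s false j else na s true j.
Proof.
move=> es; pose P t s' := [/\ env s', na s' false = na s false, sr s' 7 = sr s 8 &
  forall j, na s' true j = if (j < m)%N && (j < t)%N then na s false j else na s true j].
suff [_ _ h1 h2] : P N (run N record_cmd s).
  split=> // j; rewrite h2; case: ltnP => //= jm; by rewrite addnC ltn_addr.
rewrite /record_cmd !run_seq; apply: foldl_iota_ind => [|t s' tN [[e0 e1 e2] nE s7 H]].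
  case: es => e0 e1 e2; split=> //=; first by rewrite /fset /= add0r.
  by move=> j; rewrite andbF.
rewrite /= /fset /= e1; case: leqP => mt.
  split=> // j; rewrite H; case: ltnP => //= jm.
  by rewrite ltnS !(leq_trans _ mt) // ltnW // (leq_trans jm).
split=> //= j; rewrite /fset /= nE H [(j < t.+1)%N]ltnS [(j <= t)%N]leq_eqVlt.
by case: eqP => [->|_] //=; rewrite mt.
Qed.

Lemma body_correct Q s : good s ->
  let s' := run N (body_cmd Q) s in
  [/\ good s', sr s 7 <= sr s' 7, dg s' = dg s & achieved Q (dg s) (sr s' 7)].
Proof.
move=> [es rng tl val].
have [h1 h2 h3 h4 /andP[h5 h6]] := rules_frame Q.
cbv zeta; rewrite /body_cmd run_seq.
have es1 : env (run N init_cmd s) by apply: env_run.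
have [ls1 as1] := init_correct es.
have na1 : na (run N init_cmd s) true = na s true by rewrite run_na.
have s71 : sr (run N init_cmd s) 7 = sr s 7 by rewrite run_sr.
have dg1 : dg (run N init_cmd s) = dg s by rewrite run_dg.
move: (run N init_cmd s) es1 ls1 as1 na1 s71 dg1 => s1 es1 ls1 as1 na1 s71 dg1.
rewrite run_seq; have es2 := env_run h1 h2 h6 es1.
have [ls2 p2] := rules_correct Q es1 ls1.
have na2 : na (run N (rules_cmd Q) s1) true = na s true by rewrite run_na.
have s72 : sr (run N (rules_cmd Q) s1) 7 = sr s 7 by rewrite run_sr.
have dg2 : dg (run N (rules_cmd Q) s1) = dg s by rewrite run_dg.
move: (run N (rules_cmd Q) s1) es2 ls2 p2 na2 s72 dg2 => s2 es2 ls2 p2 na2 s72 dg2.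
rewrite as1 dg1 in p2.
rewrite run_seq; have es3 : env (run N greedy_cmd s2) by apply: env_run.
have [ls3 g3] := greedy_correct es2 ls2.
have na3 : na (run N greedy_cmd s2) true = na s true by rewrite run_na.
have s73 : sr (run N greedy_cmd s2) 7 = sr s 7 by rewrite run_sr.
have dg3 : dg (run N greedy_cmd s2) = dg s by rewrite run_dg.
move: (run N greedy_cmd s2) es3 ls3 g3 na3 s73 dg3 => s3 es3 ls3 g3 na3 s73 dg3.
rewrite run_seq; have es4 : env (run N product_cmd s3) by apply: env_run.
have pr4 := product_correct es3 ls3.
have na4 : na (run N product_cmd s3) true = na s true by rewrite run_na.
have nf4 : na (run N product_cmd s3) false = na s3 false by rewrite run_na.
have s74 : sr (run N product_cmd s3) 7 = sr s 7 by rewrite run_sr.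
have dg4 : dg (run N product_cmd s3) = dg s by rewrite run_dg.
move: (run N product_cmd s3) es4 pr4 na4 nf4 s74 dg4 => s4 es4 pr4 na4 nf4 s74 dg4.
have ach v : sr s4 8 <= v -> achieved Q (dg s) v.
  by move=> le; exists (assignment s2), (na s3 false); split=> //; rewrite -pr4.
rewrite run_ifr s74; case: leP => le; last first.
  split=> //.
  - by split=> //; rewrite ?na4 // /best_of na4 s74.
  - by rewrite s74.
  - by apply: ach; rewrite s74 ltW.
have es5 : env (run N record_cmd s4) by apply: env_run.
have dg5 : dg (run N record_cmd s4) = dg s by rewrite run_dg.
have [s75 na5] := record_correct es4.
move: (run N record_cmd s4) es5 dg5 s75 na5 => s5 es5 dg5 s75 na5.
case: g3 => g1 _ _.
split=> //; [|by rewrite s75|by apply: ach; rewrite s75].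
split=> //.
- by move=> j jm; rewrite na5 jm nf4 g1.
- by move=> j mj; rewrite na5 ltnNge mj /= na4 tl.
- rewrite s75 pr4 /best_of le_eqVlt; apply/orP; left; apply/eqP.
  apply: eq_bigr => i _; apply: eq_bigl => j.
  by rewrite na5 ltn_ord nf4.
Qed.

(** Digits from [k] on are frozen while the lower ones are swept. The recorded value never
    decreases, so what one iteration has achieved remains achieved. *)
Lemma enum_correct Q k s : good s ->
  let s' := run N (enum_cmd Q k) s in
  [/\ good s', sr s 7 <= sr s' 7, (forall i, (k <= i)%N -> dg s' i = dg s i) &
    forall dig, (forall i, (dig i < N)%N) -> (forall i, (k <= i)%N -> dig i = dg s i) ->
      achieved Q dig (sr s' 7)].
Proof.
elim: k s => [|k IH] s gs; cbv zeta.
  rewrite [enum_cmd Q 0]/=; have [g1 le1 d1 a1] := body_correct Q gs.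
  split=> // [i _|dig _ E]; first by rewrite d1.
  by rewrite (_ : dig = dg s) //; apply/funext => i; exact: E.
pose P t s' := [/\ good s', sr s 7 <= sr s' 7, (forall i, (k < i)%N -> dg s' i = dg s i) &
    forall dig, (forall i, (dig i < N)%N) -> (forall i, (k < i)%N -> dig i = dg s i) ->
      (dig k < t)%N -> achieved Q dig (sr s' 7)].
rewrite -[enum_cmd Q k.+1]/(For 10 (DMov k 10 ;; enum_cmd Q k)) run_for.
have [g1 le1 d1 a1] : P N (foldl (fun s' i => run N (DMov k 10 ;; enum_cmd Q k) (setn s' 10 i)) s (iota 0 N)).
  apply: foldl_iota_ind => [|t s' tN [g1 le1 d1 a1]]; first by split.
  rewrite run_seq; set s2 := run N (DMov k 10) _.
  have gs2 : good s2 by case: g1 => [[e0 e1 e2] q1 q2 q3]; split=> //; split.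
  have [g2 le2 d2 a2] := IH s2 gs2.
  have le12 : sr s' 7 <= sr (run N (enum_cmd Q k) s2) 7 by exact: le2.
  split=> //.
  - exact: le_trans le12.
  - by move=> i ki; rewrite d2 ?(ltnW ki) //= fsetN ?d1 // gtn_eqF.
  - move=> dig dN E; rewrite ltnS leq_eqVlt => /predU1P[dt|dlt].
      apply: a2 => // i; rewrite leq_eqVlt => /predU1P[<-|ki].
        by rewrite /= fsetE fsetE.
      by rewrite /= fsetN ?d1 ?E // gtn_eqF.
    by apply: achieved_le le12 _; exact: a1.
by split=> // dig dN E; apply: a1.
Qed.

End BodyCorrectness.

(** * Reading the input, erasing the bids, writing the output *)

Definition const_cmd x k := iter k (fun c => c ;; NInc x) (NZero x).

(* [K - 2] is the offset between the input cells [2 + j] and the cells [K + j] that are accessible as [inp j]. The last loop erases the bids. *)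
Definition copy_in_cmd K :=
  const_cmd 2 (K - 2) ;;
  For 3 (ILd 0 3 ;; RSt false 2 0 ;; NInc 2 ;; RZero 0 ;; ISt 3 0) ;;
  NMov 2 1 ;; For 3 (RSt false 2 0 ;; NInc 2) ;; NZero 2 ;; NZero 3.

Definition copy_out_cmd K :=
  const_cmd 2 (K - 2) ;; For 3 (NLd 4 true 2 ;; RCast 0 4 ;; ISt 3 0 ;; NInc 2).

Definition main_cmd Q K := copy_in_cmd K ;; enum_cmd Q (4 * Q) ;; copy_out_cmd K.

Section Copies.
Variables (R : realType) (N : nat).

Lemma run_const x k (s : state R) : run N (const_cmd x k) s = setn s x k.
Proof.
elim: k => [//|k IH]; rewrite /const_cmd iterS -/(const_cmd x k) run_seq IH /=.
rewrite /setn /= fsetE; congr State; apply/funext => j.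
by rewrite /fset; case: eqP.
Qed.

Lemma state_eq (s s' : state R) :
  sn s =1 sn s' -> sr s =1 sr s' -> dg s =1 dg s' -> (forall a, na s a =1 na s' a) ->
  (forall a, ra s a =1 ra s' a) -> inp s =1 inp s' -> s = s'.
Proof.
case: s => a1 a2 a3 a4 a5 a6; case: s' => b1 b2 b3 b4 b5 b6 /=.
move=> /funext -> /funext -> /funext -> h4 h5 /funext ->.
by congr State; apply/funext => a; apply/funext.
Qed.

Variables (n m K : nat) (w b : nat -> R).
Hypothesis K2 : (1 < K)%N.
Hypothesis NE : N = (n + m)%N.

Definition weights := fun i => if (i < m)%N then w i else 0.

(** No bid occurs here: inputs that differ only in the bids lead to the same state, and truthfulness
    rests on this. *)
Definition start_state : state R :=
  State (fset (fset (fun=> 0%N) 0 n) 1 m) (fun=> 0) (fun=> 0%N) (fun _ _ => 0%N)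
    (fun a i => if a then 0 else weights i) (fun=> 0).

Lemma copy_in_correct : run N (copy_in_cmd K) (input_state K n m w b) = start_state.
Proof.
set s0 := input_state _ _ _ _ _; pose m0 := init_mem n m w b.
have far j : (2 + N <= j)%N -> m0 j = 0 by rewrite NE; exact: init_mem_eq0.
pose fr (s' : state R) := [/\ forall x, x != 2%N -> x != 3%N -> sn s' x = sn s0 x,
  sr s' =1 fun=> 0, dg s' =1 fun=> 0%N, forall a, na s' a =1 fun=> 0%N & ra s' true =1 fun=> 0].
(* The saved cells are extended by the cells above the registers, which are cleared in passing; the
   array ends up with the item weights followed by the bids. *)
pose P1 t (s' : state R) := [/\ fr s', sn s' 2 = (K - 2 + t)%N,
  forall i, ra s' false i = (if (i < K - 2 + t)%N then m0 (2 + i)%N else 0) &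
  forall i, inp s' i = (if (i < t)%N then 0 else m0 (K + i)%N)].
rewrite /copy_in_cmd run_seq run_const run_seq.
set s1 := run N (For 3 _) _.
have : P1 N s1.
  apply: foldl_iota_ind => [|t s' tN [[f1 f2 f3 f4 f5] h2 hr hi]].
    split=> //=.
      by split=> //; move=> x x2 x3; rewrite /= fsetN.
    - by rewrite fsetE addn0.
    - by move=> i; rewrite addn0.
  rewrite /= /fset /= tN /= !tN /=.
  split=> //=.
  - split=> //=.
    + by move=> x x2 x3; rewrite /fset (negbTE x2) (negbTE x3); apply: f1.
    + by move=> x; rewrite /fset; case: eqP.
  - by rewrite /fset /= h2 addnS.
  - move=> i; rewrite /fset /= h2 hr hi ltnn; case: (eqVneq i (K - 2 + t)%N) => [->|ne].
      rewrite ifT; last by lia.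
      by congr m0; lia.
    by rewrite addnS ltnS [(i <= _)%N]leq_eqVlt (negbTE ne).
  - move=> i; rewrite /fset /= hi ltnS [(i <= t)%N]leq_eqVlt.
    by case: (eqVneq i t).
move: s1 => s1 [[f1 f2 f3 f4 f5] _ hr hi].
rewrite run_seq run_seq.
have m1 : sn s1 1 = m by rewrite f1.
set s2 := run N (For 3 _) _.
(* The bids start at index [m], so clearing [N] cells from there removes them all. *)
pose P2 t (s' : state R) := [/\ fr s', sn s' 2 = (m + t)%N,
  forall i, ra s' false i = (if (m <= i < m + t)%N then 0 else ra s1 false i) &
  inp s' =1 inp s1].
have : P2 N s2.
  apply: foldl_iota_ind => [|t s' tN [[g1 g2 g3 g4 g5] h2 gr gi]].
    split=> //=.
    - by split=> //; move=> x x2 x3; rewrite /= fsetN // f1.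
    - by rewrite fsetE m1 addn0.
    - by move=> i; rewrite addn0 ltnNge andbN.
  rewrite /= /fset /=; split=> //=.
  - by split=> //; move=> x x2 x3; rewrite /= fsetN // fsetN // g1.
  - by rewrite /fset /= h2 addnS.
  - move=> i; rewrite /fset /= h2 gr g2 addnS ltnS.
    case: (eqVneq i (m + t)%N) => [->|ne]; first by rewrite leq_addr leqnn.
    by rewrite [(i <= m + t)%N]leq_eqVlt (negbTE ne).
move: s2 => s2 [[g1 g2 g3 g4 g5] _ gr gi].
rewrite run_seq; apply: state_eq => //=.
- move=> x; rewrite /fset; case: eqP => [->//|/eqP x3]; case: eqP => [->//|/eqP x2].
  exact: g1.
- case=> i; [exact: g5|].
  rewrite gr /weights; case: (ltnP i m) => im /=.
    rewrite hr ifT; last by lia.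
    by rewrite /m0 /init_mem /= !ifT ?addKn //; lia.
  by case: ltnP => iN //; rewrite hr; case: ifP => // _; apply: far; lia.
- move=> i; rewrite gi hi; case: ltnP => // iN; apply: far; lia.
Qed.

Lemma copy_out_correct (s : state R) : let s' := run N (copy_out_cmd K) s in
  na s' true = na s true /\ forall j, (j < N)%N -> inp s' j = (na s true (K - 2 + j))%:R.
Proof.
cbv zeta; rewrite /copy_out_cmd run_seq run_const.
pose P t (s' : state R) := [/\ na s' true = na s true, sn s' 2 = (K - 2 + t)%N &
  forall j, (j < t)%N -> inp s' j = (na s true (K - 2 + j))%:R].
set s1 := run N (For 3 _) _; suff [] : P N s1 by [].
apply: foldl_iota_ind => [|t s' tN [h1 h2 h3]]; first by split=> //=; rewrite fsetE addn0.
rewrite /= /fset /= tN /=; split=> //=; first by rewrite /fset /= h2 addnS.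
move=> j; rewrite /fset /= h1 h2 ltnS leq_eqVlt => /predU1P[->|jt]; first by rewrite eqxx.
by rewrite ltn_eqF // h3.
Qed.

End Copies.

(** * Running time *)

Section RunningTime.

Lemma time_poly c : exists a k, forall N, (0 < N)%N -> (time N c <= a * N ^ k)%N.
Proof.
have le (a k k' N : nat) : (0 < N)%N -> (a * N ^ k <= a * N ^ (k + k'))%N.
  by move=> N0; rewrite leq_mul2l expnD leq_pmulr ?orbT // expn_gt0 N0.
have two c1 c2 : (exists a k, forall N, (0 < N)%N -> (time N c1 <= a * N ^ k)%N) ->
    (exists a k, forall N, (0 < N)%N -> (time N c2 <= a * N ^ k)%N) ->
    exists a k, forall N, (0 < N)%N -> (2 + (time N c1 + time N c2) <= a * N ^ k)%N.
  move=> [a1 [k1 H1]] [a2 [k2 H2]]; exists (2 + (a1 + a2))%N, (k1 + k2)%N => N N0.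
  rewrite !mulnDl !leq_add ?H1 ?H2 //.
  - by rewrite leq_pmulr // expn_gt0 N0.
  - by apply: leq_trans (H1 N N0) _; exact: le.
  - by apply: leq_trans (H2 N N0) _; rewrite addnC; exact: le.
elim: c => /=; try by move=> *; exists 7%N, 0%N => N _; rewrite expn0.
- move=> c1 H1 c2 H2; have [a [k H]] := two _ _ H1 H2.
  by exists a, k => N N0; apply: leq_trans (H N N0); rewrite leq_addl.
- by move=> _ _ c1 H1 c2 H2; exact: two.
- by move=> _ _ c1 H1 c2 H2; exact: two.
- move=> _ c [a [k H]]; exists (6 + a)%N, k.+1 => N N0.
  have := H N N0; have : (0 < N ^ k)%N by rewrite expn_gt0 N0.
  rewrite expnS; nia.
Qed.

End RunningTime.

Lemma fits_const V d x k : (x < V)%N -> fits V d (const_cmd x k).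
Proof. by move=> xV; elim: k => [//|k IH] /=; rewrite IH xV. Qed.

Lemma fits_enum V Q k d : (11 < V)%N -> (4 * Q <= V)%N -> (k <= 4 * Q)%N ->
  (d + k + 2 <= V)%N -> fits V d (enum_cmd Q k).
Proof.
move=> V12 QV; case: V V12 QV => [|[|[|[|[|[|[|[|[|[|[|[|V]]]]]]]]]]]] // _ QV.
elim: k d => [|k IH] d kQ dV /=; last by rewrite IH ?andbT //; lia.
have d0 : (d < V.+4.+4.+4)%N by lia.
have d1 : (d.+1 < V.+4.+4.+4)%N by lia.
rewrite d0 d1 /= !andbT.
elim: Q {kQ} QV => [//|Q IHQ] QV /=; rewrite IHQ /= ?d0 ?d1 ?andbT; last by lia.
by do !(apply/andP; split); lia.
Qed.

(** * Determinism of the machine *)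

Section Determinism.
Variable R : realType.

Lemma step_det P (c c1 c2 : config R) : step P c c1 -> step P c c2 -> c1 = c2.
Proof.
case=> [d p mm E lt|d p mm E lt|d a b p mm E lt|d a b p mm E lt|d a b p mm E lt
  |d a b p mm E lt b0|d a k p mm E lt ak|a s k p mm E lt ak|a b t p mm E lt ab|a b t p mm E lt ab] H;
  inversion H as [d' p' mm' E'|d' p' mm' E'|d' a' b' p' mm' E'|d' a' b' p' mm' E'|d' a' b' p' mm' E'
  |d' a' b' p' mm' E'|d' a' k' p' mm' E' lt' ak'|a' s' k' p' mm' E' lt' ak'|a' b' t' p' mm' E' lt' ab'|a' b' t' p' mm' E' lt' ab'];
  subst; rewrite E in E'; case: E' => *; subst => //.
- by move: ak'; rewrite ak => /eqP; rewrite eqr_nat => /eqP ->.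
- by move: ak'; rewrite ak => /eqP; rewrite eqr_nat => /eqP ->.
- by move: ab'; rewrite ltNge ab.
- by move: ab; rewrite ltNge ab'.
Qed.

Lemma halted_no_step P (c c' : config R) : halted P c -> ~ step P c c'.
Proof. by case=> _ E H; inversion H; subst; rewrite /= in E; congruence. Qed.

(** [DSIC] and [approx_NSW] quantify over all outputs; determinism identifies each of them with the
    one computed by the compiled program. *)
Lemma steps_det P k k' (c c1 c2 : config R) :
  steps P k c c1 -> halted P c1 -> steps P k' c c2 -> halted P c2 -> c1 = c2.
Proof.
move=> H; elim: H k' => [{}c|{}k {}c c' c'' st _ IH] k' h1 H' h2.
  by inversion H'; subst => //; case: (halted_no_step h1 H).
inversion H' as [|k'' d d' d'' st' sts']; subst; first by case: (halted_no_step h2 st).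
by rewrite (step_det st st') in IH; exact: IH h1 sts' h2.
Qed.

End Determinism.

(** * The mechanism and its guarantees *)

Section Mechanism.
Variables (R : realType) (Q : nat).
(** There are [4 * Q] digits, the loops nest to depth [4 * Q + 2] because the body adds two, and the
    other variables have indices at most 10. *)
Let V := (4 * Q + 12)%N.
Let K := (6 + 4 * V)%N.

Definition mechanism : program := whole K (main_cmd Q K).

Definition allocation (n m : nat) (w : nat -> R) : nat -> nat :=
  na (run (n + m) (enum_cmd Q (4 * Q)) (start_state n m w)) true.

Lemma main_fits : fits V 0 (main_cmd Q K).
Proof.
rewrite /main_cmd /= !fits_const ?fits_enum /V; try lia.
Qed.

Lemma weights_ge0 m (w : nat -> R) : nonneg_on m w -> nonneg_on m (weights m w).
Proof. by move=> w0 j jm; rewrite /weights jm w0. Qed.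

Lemma bundle_weights m (w : nat -> R) A i : bundle_w m (weights m w) A i = bundle_w m w A i.
Proof. by apply: eq_bigr => j _; rewrite /weights ltn_ord. Qed.

Lemma start_good n m (w : nat -> R) : (0 < n)%N -> nonneg_on m w ->
  good n m (weights m w) (start_state n m w).
Proof.
move=> n0 w0; split=> //.
by apply: prodr_ge0 => i _; apply: bundle_ge0; exact: weights_ge0.
Qed.

(** Output cells below [K] are written by the epilogue, the others by [copy_out_cmd]; both take
    entry [j] of the best allocation to cell [2 + j]. *)
Lemma mechanism_halts n m (w b : nat -> R) : (0 < n)%N -> nonneg_on m w ->
  exists k c, [/\ (k <= size (prologue K) + time (n + m) (main_cmd Q K) + size (epilogue K))%N,
    steps mechanism k (Config 0 (init_mem n m w b)) c, halted mechanism c &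
    decodes n m (mem c) (allocation n m w) (fun=> 0)].
Proof.
move=> n0 w0; have V1 : (1 < V)%N by rewrite /V; lia.
have [k [c [kT st hc out]]] :=
  @whole_runs R V K V1 (erefl K) n m w b n0 (2 ^ K * (n + m))%N erefl _ main_fits.
exists k, c; split=> //.
have K2 : (1 < K)%N by rewrite /K; lia.
have [g _ _ _] := enum_correct n0 (weights_ge0 w0) Q (4 * Q) (start_good n0 w0).
have cell j : (j < n + m)%N -> mem c (2 + j)%N = (allocation n m w j)%:R.
  move=> jN; rewrite out // /main_cmd run_seq copy_in_correct // run_seq.
  set s1 := run _ (enum_cmd _ _) _.
  have [naE inE] := copy_out_correct (n + m) K s1.
  rewrite naE; case: ltnP => // Kj.
  rewrite inE; last by lia.
  by congr (na s1 true _)%:R; rewrite /K; lia.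
split=> [j jm|i ni].
  split; first exact: (good_range g).
  by rewrite cell // addnC ltn_addr.
rewrite -addnA cell; last by rewrite addnC ltn_add2r.
by rewrite /allocation (good_tail g) // leq_addr.
Qed.

Lemma mechanism_poly_time : poly_time R mechanism.
Proof.
have [a [k H]] := time_poly (main_cmd Q K).
exists (size (prologue K) + a + size (epilogue K))%N, k => n m w b n0 w0 b0.
exists (allocation n m w), (fun=> 0).
have [j [c [jT st hc dc]]] := mechanism_halts b n0 w0.
exists j, c; split=> //.
have N0 : (0 < n + m)%N by rewrite addn_gt0 n0.
apply: (leq_trans jT); rewrite !mulnDl !leq_add ?H // leq_pmulr //;
  by rewrite expn_gt0 N0.
Qed.

Lemma mechanism_outputs n m (w b : nat -> R) A p : (0 < n)%N -> nonneg_on m w ->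
  outputs mechanism n m w b A p ->
  (forall j, (j < m)%N -> A j = allocation n m w j) /\ (forall i, (i < n)%N -> p i = 0).
Proof.
move=> n0 w0 [T [k [c [_ [st [hc [d1 d2]]]]]]].
have [k' [c' [_ st' hc' [d1' d2']]]] := mechanism_halts b n0 w0.
have E := steps_det st hc st' hc'; subst c'.
split=> [j jm|i ni]; last by rewrite d2 // -d2'.
have [_ e1] := d1 j jm; have [_ e2] := d1' j jm.
by apply/eqP; rewrite -(eqr_nat R) -e1 e2.
Qed.

Lemma bundle_allocation n m (w b : nat -> R) A p i : (0 < n)%N -> nonneg_on m w ->
  outputs mechanism n m w b A p -> bundle_w m w A i = bundle_w m w (allocation n m w) i.
Proof.
move=> n0 w0 /(mechanism_outputs n0 w0) [AE _].
by apply: eq_bigl => j; rewrite AE.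
Qed.

(** A changed bid changes neither the allocation nor the payments, which are 0; truthful utility is
    then a product of nonnegative numbers. *)
Lemma mechanism_DSIC : DSIC R mechanism.
Proof.
move=> n m w b i vi bi A A' p p' n0 w0 b0 ni vi0 bi0 o o'.
rewrite (bundle_allocation _ n0 w0 o) (bundle_allocation _ n0 w0 o').
have [_ p0] := mechanism_outputs n0 w0 o; have [_ p0'] := mechanism_outputs n0 w0 o'.
rewrite p0 // p0' // lexx; split=> //.
by rewrite subr0 mulr_ge0 // bundle_ge0.
Qed.

End Mechanism.

Lemma allocation_near_optimal (R : realType) (q n m : nat) (w : nat -> R) S :
  (7 < q)%N -> (0 < n)%N -> nonneg_on m w -> is_partition n m S ->
  \prod_(i < n) bundle_w m w S i <=
    (1 + 20 / q%:R) ^+ n * \prod_(i < n) bundle_w m w (allocation (rules q) n m w) i.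
Proof.
move=> q7 n0 w0 Sp; have c0 : 0 <= 1 + 20 / q%:R :> R by rewrite addr_ge0 // divr_ge0.
have rhs0 A : 0 <= (1 + 20 / q%:R) ^+ n * \prod_(i < n) bundle_w m w A i.
  rewrite mulr_ge0 ?exprn_ge0 // prodr_ge0 // => i _; exact: bundle_ge0.
(* The structure of the optimum was derived for a positive product; a zero product needs no
   approximation. *)
have [le|pos] := leP (\prod_(i < n) bundle_w m w S i) 0; first exact: le_trans le (rhs0 _).
have w0' := weights_ge0 w0.
have pE A : \prod_(i < n) bundle_w m (weights m w) A i = \prod_(i < n) bundle_w m w A i.
  by apply: eq_bigr => i _; rewrite bundle_weights.
have [|dig dN near] := some_code_near_optimal q7 n0 w0' Sp; first by rewrite pE.
set Q := rules q in near *.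
(* Only the first [4 * Q] digits are swept and read; the others must agree with [start_state], where
   they are 0. *)
pose dig' i := if (i < 4 * Q)%N then dig i else 0%N.
have N0 : (0 < n + m)%N by rewrite addn_gt0 n0.
have dN' i : (dig' i < n + m)%N by rewrite /dig'; case: ifP.
have [g _ _ ach] := enum_correct n0 w0' Q (4 * Q) (start_good n0 w0).
have [|A0 [A [pA gA leA]]] := ach dig' dN'.
  by move=> i Qi; rewrite /dig' ltnNge Qi.
have digE : demands n (weights m w) (n + m) dig' Q = demands n (weights m w) (n + m) dig Q.
  rewrite /demands; congr flatten; apply/eq_in_map => r; rewrite mem_iota => /= rQ.
  by rewrite /rule_demands /dig' !ifT //; lia.
rewrite digE in pA.
have := near A0 A pA gA; rewrite pE => h; apply: (le_trans h).
apply: ler_wpM2l; first exact: exprn_ge0.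
apply: (le_trans leA); apply: (le_trans (good_value g)).
by rewrite /best_of pE.
Qed.

Lemma mechanism_approx (R : realType) (eps : R) q : 0 < eps -> (7 < q)%N ->
  20 / q%:R <= eps -> approx_NSW eps (mechanism (rules q)).
Proof.
move=> eps0 q7 qe n m w v A p n0 w0 v0 out S Sp.
have e0 : 0 < 1 + eps by rewrite addr_gt0.
have n1 : n%:R != 0 :> R by rewrite pnatr_eq0 -lt0n.
rewrite /NSW ler_pdivrMl //.
(* Written as an [n]-th root, the factor joins the product under one root; the product of the [v i]
   is then common to both sides. *)
have -> : 1 + eps = powR ((1 + eps) ^+ n) (n%:R^-1).
  by rewrite -powR_mulrn ?ltW // -powRrM divff // powRr1 // ltW.
have P0 X : 0 <= \prod_(i < n) (v i * bundle_w m w X i).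
  by apply: prodr_ge0 => i _; rewrite mulr_ge0 ?bundle_ge0 // v0.
rewrite -powRM ?exprn_ge0 ?(ltW e0) //.
apply: ge0_ler_powR; rewrite ?nnegrE ?invr_ge0 ?mulr_ge0 ?exprn_ge0 ?(ltW e0) //.
rewrite !big_split /= mulrCA; apply: ler_wpM2l.
  by apply: prodr_ge0 => i _; rewrite v0.
apply: (le_trans (allocation_near_optimal q7 n0 w0 Sp)).
have -> : \prod_(i < n) bundle_w m w A i =
    \prod_(i < n) bundle_w m w (allocation (rules q) n m w) i.
  by apply: eq_bigr => i _; rewrite (bundle_allocation _ n0 w0 out).
apply: ler_wpM2r; first by apply: prodr_ge0 => i _; exact: bundle_ge0.
by rewrite lerXn2r ?nnegrE ?addr_ge0 ?divr_ge0 ?ler0n ?(ltW eps0) // lerD2l.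
Qed.

Theorem theorem3 (R : realType) :
  forall eps : R, 0 < eps ->
    exists P : program,
      poly_time R P /\ DSIC R P /\ approx_NSW eps P.
Proof.
(* The summand 8 secures [7 < q], the other one [20 / q <= eps]. *)
move=> eps eps0; pose q := ((Num.truncn (20 / eps)).+1 + 8)%N.
exists (mechanism (rules q)); split; first exact: mechanism_poly_time.
split; first exact: mechanism_DSIC.
apply: mechanism_approx => //; first by rewrite /q addnC.
have h : 20 / eps < q%:R by apply: lt_le_trans (truncnS_gt _) _; rewrite ler_nat leq_addr.
rewrite ler_pdivrMr ?ltr0n // mulrC -ler_pdivrMr //; exact: ltW.
Qed.
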